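(* Let $A$ generate a $C_0$-semigroup $(T(t))_{t\ge 0}$ on a Banach space $X$ and let $U$ be a Banach space. Let $B\in\mathcal{L}(U,X_{-1})$ be $\mathrm{C}$-admissible and assume that the mild solution is continuous with respect to time in the $X$-norm for every $u\in\mathrm{C}([0,\infty),U)$. Let $q\in[1,\infty)$. If there exists a non-coercive $q$-homogeneous ISS Lyapunov function in a dissipative form for $\Sigma(A,B)$, then $\Sigma(A,B)$ is $L^q$-$L^q$-ISS.
   Context: For a $C_0$-semigroup $(T(t))_{t\ge0}$ with generator $A$ on a Banach space $X$, the extrapolation space $X_{-1}$ is the completion of $X$ with respect to $\|x\|_{-1}:=\|(\lambda-A)^{-1}x\|$ for a fixed $\lambda\in\rho(A)$ (different choices give equivalent norms). The semigroup extends uniquely to a $C_0$-semigroup $(T_{-1}(t))_{t\ge0}$ on $X_{-1}$, whose generator $A_{-1}$ extends $A$ and has domain $X$. For $B\in\mathcal{L}(U,X_{-1})$, $\Sigma(A,B)$ denotes the system $\dot x(t)=Ax(t)+Bu(t)$, $t\ge0$, $x(0)=x_0$. For $\tau\ge0$ and an input $u$ put $\Phi_\tau u:=\int_0^\tau T_{-1}(\tau-s)Bu(s)\,ds\in X_{-1}$; the mild solution is $\phi(\tau,x_0,u)=T(\tau)x_0+\Phi_\tau u\in X_{-1}$ for $x_0\in X$. $B$ (or $\Sigma(A,B)$) is $\mathrm{C}$-admissible if for some (equivalently, all) $\tau>0$, $u\in\mathrm{C}([0,\tau],U)$ implies $\Phi_\tau u\in X$. The Lie derivative of $V:X\to\mathbb{R}$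 at $x\in X$ corresponding to the input $u$ is $\dot V_u(x):=\limsup_{t\downarrow0}\frac1t\big(V(\phi(t,x,u))-V(x)\big)$. For $q\in[1,\infty)$ and $\Sigma(A,B)$ $\mathrm{C}$-admissible, a continuous $V:X\to[0,\infty)$ is a $q$-homogeneous non-coercive ISS Lyapunov function in a dissipative form for $\Sigma(A,B)$ if $V(ax)=|a|^qV(x)$ for all $a\in\mathbb{R}$, $x\in X$, and there exist $a_2,a_3,a_4>0$ such that $0<V(x)\le a_2\|x\|^q$ for all $x\in X\setminus\{0\}$ and $\dot V_u(x)\le-a_3\|x\|^q+a_4\|u(0)\|_U^q$ for all $x\in X$, $u\in\mathrm{C}([0,\infty),U)$. $\mathcal{K}_\infty$ is the set of continuous, strictly increasing, unbounded functions $\gamma:[0,\infty)\to[0,\infty)$ with $\gamma(0)=0$. $\Sigma(A,B)$ is $L^q$-$L^q$-admissible if for some (equivalently, all) $t>0$, $u\in L^q([0,t],U)$ implies $\Phi_{(\cdot)}u\in L^q([0,t],X)$. $\Sigma(A,B)$ is $L^q$-$L^q$-ISS if it is $L^q$-$L^q$-admissible and there are $\sigma,\gamma\in\mathcal{K}_\infty$ such that $\|\phi(\cdot,x,u)\|_{L^q([0,t],X)}\le\sigma(\|x\|)+\gamma(\|u\|_{L^q([0,t],U)})$ for all $t\ge0$, $x\in X$, $u\in L^q([0,t],U)$. *)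

(* Defs.v *)
From HB Require Import structures.
From mathcomp Require Import all_boot all_order all_algebra.
From mathcomp Require Import all_classical all_reals all_analysis.
Import Order.TTheory GRing.Theory Num.Theory.
Import numFieldNormedType.Exports.

Set Implicit Arguments.
Unset Strict Implicit.
Unset Printing Implicit Defensive.

Local Open Scope classical_set_scope.
Local Open Scope ring_scope.

(** * Bochner integration over bounded intervals of the real line *)

Section Bochner.
Context {R : realType} {E : normedModType R}.

(* A list [:: (A_1, c_1); ...; (A_n, c_n)] of measurable sets and vectors stands
   for the simple function \sum_i 1_{A_i} c_i. *)
Definition is_simple (s : seq (set R * E)) : Prop :=
  forall p, p \in s -> measurable p.1.

Definition simple_eval (s : seq (set R * E)) (x : R) : E :=
  \sum_(p <- s) (\1_(p.1) x : R) *: p.2.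

Definition simple_integral (I : set R) (s : seq (set R * E)) : E :=
  \sum_(p <- s) fine (lebesgue_measure (p.1 `&` I)) *: p.2.

(* [measurable] refers to Borel sets here. Every almost-everywhere class of
   strongly (Lebesgue) measurable functions has a representative which is an
   everywhere limit of Borel simple functions, so that nothing is lost on the
   level of the spaces L^q, whose elements are such classes. *)
Definition strongly_measurable (I : set R) (f : R -> E) : Prop :=
  exists s : nat -> seq (set R * E),
    (forall n, is_simple (s n)) /\
    (forall x, I x -> simple_eval (s n) x @[n --> \oo] --> f x).

Definition is_bochner_integral (I : set R) (f : R -> E) (v : E) : Prop :=
  strongly_measurable I f /\
  exists s : nat -> seq (set R * E),
    [/\ forall n, is_simple (s n),
        (\int[lebesgue_measure]_(x in I) (`|f x - simple_eval (s n) x|)%:E)%E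
          @[n --> \oo] --> 0%E
      & simple_integral I (s n) @[n --> \oo] --> v].

Definition bochner_integral (I : set R) (f : R -> E) : E :=
  xget 0 [set v | is_bochner_integral I f v].

Definition Lq_norm (q t : R) (f : R -> E) : \bar R :=
  ('N[lebesgue_measure]_(q%:E)[(fun s => (`|f s|)%:E) \_ `[0%R, t] ])%E.

Definition in_Lq (q t : R) (f : R -> E) : Prop :=
  strongly_measurable `[0, t] f /\ (Lq_norm q t f < +oo)%E.

End Bochner.

Section Operators.
Context {R : realType}.

Definition bounded_operator (E F : normedModType R) (f : E -> F) : Prop :=
  linear f /\ continuous f.

(* Only the values T t with 0 <= t are relevant. *)
Definition C0_semigroup (E : normedModType R) (T : R -> E -> E) : Prop :=
  [/\ forall t, 0 <= t -> bounded_operator (T t),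
      forall x, T 0 x = x,
      forall s t x, 0 <= s -> 0 <= t -> T (s + t) x = T s (T t x)
    & forall x, T t x @[t --> 0^'+] --> x].

(* An unbounded operator is given by its domain D and a function A whose values
   outside D are irrelevant. *)
Definition generates (E : normedModType R) (D : set E) (A : E -> E)
    (T : R -> E -> E) : Prop :=
  C0_semigroup T /\
  forall x y, (h^-1 *: (T h x - x) @[h --> 0^'+] --> y) <-> (D x /\ A x = y).

Definition is_resolvent (E : normedModType R) (D : set E) (A : E -> E)
    (lambda : R) (Rl : E -> E) : Prop :=
  [/\ bounded_operator Rl,
      forall x, D (Rl x) /\ lambda *: Rl x - A (Rl x) = x
    & forall x, D x -> Rl (lambda *: x - A x) = x].

(* Scalars are real; a complex Banach space is covered as a real one, because
   the resolvent set of a generator contains large real numbers.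
   The complete space Xm1, with the embedding j, is the completion of X for the
   norm x |-> |Rl x|, where Rl is the resolvent at a fixed point. *)
Definition is_extrapolation_space (X : normedModType R)
    (Xm1 : completeNormedModType R) (Rl : X -> X) (j : X -> Xm1) : Prop :=
  [/\ linear j, forall x, `|j x| = `|Rl x| & dense (range j)].

Definition is_extension_semigroup (X Xm1 : normedModType R) (j : X -> Xm1)
    (T : R -> X -> X) (Tm1 : R -> Xm1 -> Xm1) : Prop :=
  C0_semigroup Tm1 /\ forall t x, 0 <= t -> Tm1 t (j x) = j (T t x).

Definition class_Kinf (g : R -> R) : Prop :=
  [/\ g 0 = 0, {within `[0, +oo[, continuous g},
      forall r s, 0 <= r -> r < s -> g r < g s
    & forall M, exists2 r, 0 <= r & M < g r].

End Operators.

Section System.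
Context {R : realType} {X U Xm1 : completeNormedModType R}.
Variables (j : X -> Xm1) (T : R -> X -> X) (Tm1 : R -> Xm1 -> Xm1).
Variable B : U -> Xm1.

Definition Phi (tau : R) (u : R -> U) : Xm1 :=
  bochner_integral `[0, tau] (fun s => Tm1 (tau - s) (B (u s))).

Definition mild (tau : R) (x : X) (u : R -> U) : Xm1 :=
  j (T tau x) + Phi tau u.

(* The element of X corresponding to an element of j(X) (and 0 off j(X)). *)
Definition toX (y : Xm1) : X := xget 0 [set x | j x = y].

Definition C_admissible : Prop :=
  exists2 tau : R, 0 < tau &
    forall u : R -> U, {within `[0, tau], continuous u} -> range j (Phi tau u).

Definition continuous_mild_solutions : Prop :=
  forall (x : X) (u : R -> U), {within `[0, +oo[, continuous u} ->
    exists2 phi : R -> X, {within `[0, +oo[, continuous phi} &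
      forall t, 0 <= t -> j (phi t) = mild t x u.

Definition lie_derivative (V : X -> R) (u : R -> U) (x : X) : \bar R :=
  limf_esup (fun t : R => (t^-1 * (V (toX (mild t x u)) - V x))%:E) 0^'+.

Definition noncoercive_ISS_Lyapunov (q : R) (V : X -> R) : Prop :=
  [/\ continuous V,
      forall x, 0 <= V x,
      forall (a : R) x, V (a *: x) = `|a| `^ q * V x
    & exists a2 a3 a4 : R,
      [/\ 0 < a2, 0 < a3, 0 < a4,
          forall x : X, x != 0 -> 0 < V x /\ V x <= a2 * `|x| `^ q
        & forall (x : X) (u : R -> U), {within `[0, +oo[, continuous u} ->
            (lie_derivative V u x <=
             (- a3 * `|x| `^ q + a4 * `|u 0%R| `^ q)%:E)%E]].

(* The Xm1-valued function f "is" the element g of L^q([0,t],X). Since j is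
   injective, g is unique up to equality almost everywhere. *)
Definition represents_Lq (q t : R) (f : R -> Xm1) (g : R -> X) : Prop :=
  in_Lq q t g /\ {ae lebesgue_measure, forall s : R, s \in `[0, t] -> j (g s) = f s}.

Definition LqLq_admissible (q : R) : Prop :=
  exists2 t : R, 0 < t &
    forall u : R -> U, in_Lq q t u ->
      exists g, represents_Lq q t (fun s => Phi s u) g.

Definition LqLq_ISS (q : R) : Prop :=
  LqLq_admissible q /\
  exists sigma gamma : R -> R,
    [/\ class_Kinf sigma, class_Kinf gamma
      & forall (t : R) (x : X) (u : R -> U), 0 <= t -> in_Lq q t u ->
          exists2 g : R -> X, represents_Lq q t (fun s => mild s x u) g &
            (Lq_norm q t g <=
             (sigma `|x| + gamma (fine (Lq_norm q t u)))%:E)%E].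

End System.

(* Main.v *)
Require Import Defs.
From HB Require Import structures.
From mathcomp Require Import all_boot all_order all_algebra.
From mathcomp Require Import all_classical all_reals all_analysis.
From mathcomp Require Import measurable_realfun ring lra.
Import Order.TTheory GRing.Theory Num.Theory.
Import numFieldNormedType.Exports.
Set Implicit Arguments.
Unset Strict Implicit.
Unset Printing Implicit Defensive.
Local Open Scope classical_set_scope.
Local Open Scope ring_scope.

(* Along a mild solution for a continuous input, t |-> V (phi t) is continuous
   and its upper right Dini derivative is at most - a3 |phi t|^q + a4 |u t|^q,
   by the cocycle property. Integrating and dropping V (phi t) >= 0 gives
     int |phi|^q <= K (|x|^q + int |u|^q),   K = (a2 + a4) / a3;
   no lower bound on V (coercivity) is needed. By linearity, applied to
   differences, this makes the solutions for continuous inputs w_n -> u in L^q a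
   Cauchy sequence in L^q([0, t], X); along a fast sequence they converge almost
   everywhere in X. They also converge to the mild solution for u in X_{-1} at
   every time, since the inputs converge in L^1 as well; hence this mild solution
   is X-valued almost everywhere, and Fatou's lemma transfers the estimate. *)

(** * Simple functions *)

(** [Phi] is a Bochner integral picked out by choice, so its existence for L^1 inputs, its
    linearity, its norm bound and the cocycle law all have to be derived from approximating simple
    functions. The Lyapunov hypothesis bounds only a limsup from the right, for continuous inputs.
    The inequality V(phi t) + a3 int |phi|^q <= V x + a4 int |u|^q therefore comes from a comparison
    argument and not from differentiating V; K merges the quotients a2/a3 and a4/a3 into one
    constant. The estimate reaches differences because two solutions with the same initial state
    differ by the solution from 0 for the difference of the inputs. The fast sequence has rate (2
    2^q)^-n: after weighting the n-th step with 2^(qn) a summable 2^-n remains, so that almost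
    everywhere the pointwise steps are O(2^-n). In the final bound the integral of |u|^q carries a
    factor 2^q, the price of passing from u to its approximants w_n. *)

Section Simple.
Context {R : realType}.
Implicit Types E F : normedModType R.
Notation mu := (@lebesgue_measure R).

Lemma simple_eval_cons E (p : set R * E) s x :
  simple_eval (p :: s) x = \1_(p.1) x *: p.2 + simple_eval s x.
Proof. by rewrite /simple_eval big_cons. Qed.

Lemma simple_eval_cat E (s s' : seq (set R * E)) x :
  simple_eval (s ++ s') x = simple_eval s x + simple_eval s' x.
Proof. by rewrite /simple_eval big_cat. Qed.

Lemma simple_integral_cat E I (s s' : seq (set R * E)) :
  simple_integral I (s ++ s') = simple_integral I s + simple_integral I s'.
Proof. by rewrite /simple_integral big_cat. Qed.

Lemma is_simple_cons E (p : set R * E) s :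
  is_simple (p :: s) <-> measurable p.1 /\ is_simple s.
Proof.
split=> [h|[h1 h2] p']; last by rewrite inE => /predU1P[->//|/h2].
by split; [apply: h; rewrite mem_head|move=> p' ps; apply: h; rewrite inE ps orbT].
Qed.

Lemma is_simple_cat E (s s' : seq (set R * E)) :
  is_simple s -> is_simple s' -> is_simple (s ++ s').
Proof. by move=> hs hs' p; rewrite mem_cat => /orP[/hs|/hs']. Qed.

Definition simple_map E F (h : E -> F) (s : seq (set R * E)) : seq (set R * F) :=
  [seq (p.1, h p.2) | p <- s].

Definition simple_restrict E (C : set R) (s : seq (set R * E)) :=
  [seq (p.1 `&` C, p.2) | p <- s].

Lemma is_simple_map E F (h : E -> F) s : is_simple s -> is_simple (simple_map h s).
Proof. by move=> hs p /mapP[p' /hs mp' ->]. Qed.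

Lemma is_simple_restrict E (C : set R) (s : seq (set R * E)) :
  measurable C -> is_simple s -> is_simple (simple_restrict C s).
Proof. by move=> mC hs p /mapP[p' /hs mp' ->] /=; exact: measurableI. Qed.

Section LinearProp.
Context (E F : normedModType R) (h : E -> F) (lh : linear h).
(** Operators are bare functions with a proof of [linear]; packing them locally gives access to the
    library of linear maps. *)
Let h' : {linear E -> F} := HB.pack h (GRing.isLinear.Build _ _ _ _ _ lh).

Lemma linear_prop0 : h 0 = 0. Proof. exact: (raddf0 h'). Qed.

Lemma linear_propD x y : h (x + y) = h x + h y. Proof. exact: (raddfD h'). Qed.

Lemma linear_propB x y : h (x - y) = h x - h y. Proof. exact: (raddfB h'). Qed.

Lemma linear_propZ a x : h (a *: x) = a *: h x. Proof. exact: (linearZ_LR h'). Qed.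

Lemma linear_prop_sum (I : Type) (r : seq I) (f : I -> E) :
  h (\sum_(i <- r) f i) = \sum_(i <- r) h (f i).
Proof. exact: (raddf_sum h'). Qed.

End LinearProp.

Lemma simple_eval_map E F (h : E -> F) s x : linear h ->
  simple_eval (simple_map h s) x = h (simple_eval s x).
Proof.
move=> lh; rewrite /simple_eval /simple_map big_map (linear_prop_sum lh).
by apply: eq_bigr => p _; rewrite (linear_propZ lh).
Qed.

Lemma simple_integral_map E F I (h : E -> F) s : linear h ->
  simple_integral I (simple_map h s) = h (simple_integral I s).
Proof.
move=> lh; rewrite /simple_integral /simple_map big_map (linear_prop_sum lh).
by apply: eq_bigr => p _; rewrite (linear_propZ lh).
Qed.

Lemma simple_eval_restrict E C (s : seq (set R * E)) x :
  simple_eval (simple_restrict C s) x = \1_C x *: simple_eval s x.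
Proof.
rewrite /simple_eval /simple_restrict big_map scaler_sumr.
apply: eq_bigr => p _ /=; rewrite scalerA indicI; congr (_ *: _).
by rewrite /= mulrC.
Qed.

Lemma linear_opp E : linear (fun x : E => - x).
Proof. by move=> a x y; rewrite opprD scalerN. Qed.

Definition simple_sub E (s s' : seq (set R * E)) := s ++ simple_map -%R s'.

Lemma is_simple_sub E (s s' : seq (set R * E)) :
  is_simple s -> is_simple s' -> is_simple (simple_sub s s').
Proof. by move=> hs hs'; apply: is_simple_cat => //; exact: is_simple_map. Qed.

Lemma simple_eval_sub E (s s' : seq (set R * E)) x :
  simple_eval (simple_sub s s') x = simple_eval s x - simple_eval s' x.
Proof. by rewrite simple_eval_cat (@simple_eval_map _ _ -%R)//; exact: linear_opp. Qed.

Lemma simple_integral_sub E I (s s' : seq (set R * E)) :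
  simple_integral I (simple_sub s s') = simple_integral I s - simple_integral I s'.
Proof. by rewrite simple_integral_cat (@simple_integral_map _ _ _ -%R)//; exact: linear_opp. Qed.

(** [E] carries no sigma-algebra, so measurability is expressed through a real function [g] of the
    values. Any [g] is allowed, since only finitely many values occur; the induction generalises [g]
    to absorb the first vector as a translation. *)
Lemma measurable_simple_comp E (g : E -> R) s : is_simple s ->
  measurable_fun setT (fun x : R => g (simple_eval s x)).
Proof.
elim: s g => [|p s IH] g.
  move=> _; rewrite (_ : (fun x => _) = cst (g 0)) //; apply/funext => x.
  by rewrite /simple_eval big_nil.
move=> /is_simple_cons[mp hs].
rewrite (_ : (fun x => _) = (fun x => if x \in p.1 then g (p.2 + simple_eval s x)
   else g (simple_eval s x))).
  apply: measurable_fun_ifT => //.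
  - apply: (@measurable_fun_bool _ _ _ _ true) => //.
    rewrite setTI (_ : _ @^-1` _ = p.1)//.
    by apply/seteqP; split=> x /= xp; [exact: set_mem|exact: mem_set].
  - exact: (IH (fun e => g (p.2 + e))).
  - exact: IH.
apply/funext => x; rewrite simple_eval_cons indicE.
by case: (x \in p.1); rewrite ?scale1r// scale0r add0r.
Qed.

(* The offset [w] makes the induction on the list go through: splitting [I] along
   the first set [A] of the list moves its vector into the offset on [I `&` A]. *)
Lemma simple_integral_offset_le E (s : seq (set R * E)) (I : set R) (w : E) :
  is_simple s -> measurable I -> (mu I < +oo)%E ->
  ((`|fine (mu I) *: w + simple_integral I s|)%:E <=
    \int[mu]_(x in I) (`|w + simple_eval s x|)%:E)%E.
Proof.
elim: s I w => [|p s IH] I w.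
  move=> _ mI fI; rewrite /simple_integral big_nil addr0.
  under eq_integral do rewrite /simple_eval big_nil addr0.
  rewrite integral_cst// normrZ ger0_norm ?fine_ge0// mulrC EFinM fineK//.
  by rewrite ge0_fin_numE.
move=> /is_simple_cons[mp hs] mI fI.
have mIA : measurable (I `&` p.1) by exact: measurableI.
have mID : measurable (I `\` p.1) by exact: measurableD.
have fIA : (mu (I `&` p.1) < +oo)%E.
  by apply: le_lt_trans fI; rewrite le_measure ?inE//; exact: subIsetl.
have fID : (mu (I `\` p.1) < +oo)%E.
  by apply: le_lt_trans fI; rewrite le_measure ?inE//; exact: subDsetl.
have mono (A B : set R) : measurable A -> measurable B -> A `<=` B -> (mu A <= mu B)%E.
  by move=> mA mB AB; apply: le_measure; rewrite ?inE.
have finA (A : set R) : (mu A < +oo)%E -> mu A \is a fin_num by rewrite ge0_fin_numE.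
have splitmu (C : set R) : measurable C -> fine (mu (C `&` I)) =
    fine (mu (C `&` (I `&` p.1))) + fine (mu (C `&` (I `\` p.1))).
  move=> mC; rewrite (@measureDI _ _ _ mu _ p.1)//; last exact: measurableI.
  rewrite setIDA setIA addrC fineD//.
  - apply/finA; apply: le_lt_trans fIA; rewrite -setIA; apply: mono => //; exact: measurableI.
  - apply/finA; apply: le_lt_trans fID; rewrite -setIDA; apply: mono => //; exact: measurableI.
have sE : simple_integral I s = simple_integral (I `&` p.1) s + simple_integral (I `\` p.1) s.
  rewrite /simple_integral -big_split /=; apply: eq_big_seq => p' /hs mp'.
  by rewrite -scalerDl splitmu.
have -> : fine (mu I) *: w + simple_integral I (p :: s) =
    (fine (mu (I `&` p.1)) *: (w + p.2) + simple_integral (I `&` p.1) s) +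
    (fine (mu (I `\` p.1)) *: w + simple_integral (I `\` p.1) s).
  have := splitmu setT measurableT; rewrite !setTI => ->.
  rewrite {1}/simple_integral big_cons -/(simple_integral _ _) sE setIC.
  rewrite scalerDl scalerDr -!addrA; congr (_ + _).
  rewrite [LHS]addrCA; congr (_ + _); exact: addrCA.
have mf : measurable_fun I (EFin \o (fun e => `|w + e| : R) \o simple_eval (p :: s)).
  apply/measurable_EFinP; apply: measurable_funTS.
  by apply: (measurable_simple_comp (fun e => `|w + e|)); apply/is_simple_cons.
rewrite -[X in (_ <= integral _ X _)%E](setUIDK I p.1) ge0_integral_setU//; [|by rewrite setUIDK|]; last first.
  by rewrite disj_set2E; apply/eqP/seteqP; split=> // x [[_ ?] [_]].
apply: (@le_trans _ _ (_ + _)%:E); first by rewrite lee_fin; exact: ler_normD.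
rewrite EFinD; apply: leeD.
- apply: le_trans (IH _ _ hs mIA fIA) _; rewrite le_eqVlt; apply/orP; left; apply/eqP.
  apply: eq_integral => x; rewrite inE => -[_ px].
  by rewrite simple_eval_cons indicE mem_set// scale1r addrA.
- apply: le_trans (IH _ _ hs mID fID) _; rewrite le_eqVlt; apply/orP; left; apply/eqP.
  apply: eq_integral => x; rewrite inE => -[_ px].
  by rewrite simple_eval_cons indicE memNset// scale0r add0r.
Qed.

Lemma simple_integral_le E (s : seq (set R * E)) (I : set R) :
  is_simple s -> measurable I -> (mu I < +oo)%E ->
  ((`|simple_integral I s|)%:E <= \int[mu]_(x in I) (`|simple_eval s x|)%:E)%E.
Proof.
move=> hs mI fI; have := simple_integral_offset_le 0 hs mI fI.
by rewrite scaler0 add0r; under eq_integral do rewrite add0r.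
Qed.
End Simple.

(** * The Bochner integral *)

Section NonnegIntegral.
Context {R : realType} (I : set R) (mI : measurable I).
Notation mu := (@lebesgue_measure R).
Implicit Types f g : R -> R.

Lemma le_integral_EFin f g : (forall x, I x -> 0 <= f x) ->
  measurable_fun I f -> measurable_fun I g -> (forall x, I x -> f x <= g x) ->
  (\int[mu]_(x in I) (f x)%:E <= \int[mu]_(x in I) (g x)%:E)%E.
Proof.
move=> f0 mf mg fg; apply: ge0_le_integral => //; try exact/measurable_EFinP.
Qed.

Lemma integral_EFinD f g : (forall x, I x -> 0 <= f x) -> (forall x, I x -> 0 <= g x) ->
  measurable_fun I f -> measurable_fun I g ->
  (\int[mu]_(x in I) (f x + g x)%:E =
   \int[mu]_(x in I) (f x)%:E + \int[mu]_(x in I) (g x)%:E)%E.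
Proof.
move=> f0 g0 mf mg; under eq_integral do rewrite EFinD.
by apply: ge0_integralD => //; try exact/measurable_EFinP.
Qed.

Lemma integral_EFinZ f k : (forall x, I x -> 0 <= f x) -> 0 <= k ->
  measurable_fun I f ->
  (\int[mu]_(x in I) (k * f x)%:E = k%:E * \int[mu]_(x in I) (f x)%:E)%E.
Proof.
move=> f0 k0 mf; under eq_integral do rewrite EFinM.
by apply: ge0_integralZl => //; try exact/measurable_EFinP.
Qed.

Lemma integral_EFin_ge0 f : (forall x, I x -> 0 <= f x) ->
  (0 <= \int[mu]_(x in I) (f x)%:E)%E.
Proof. by move=> f0; apply: integral_ge0 => x Ix; rewrite lee_fin f0. Qed.

End NonnegIntegral.

Lemma cvge0_leP {R : realType} (u : nat -> \bar R) : (forall n, (0 <= u n)%E) ->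
  (u @ \oo --> 0%E) <-> forall e : R, 0 < e -> \forall n \near \oo, (u n <= e%:E)%E.
Proof.
move=> u0; split=> [/fine_cvgP[ufin /cvgr0Pnorm_le ucvg] e e0|h].
  near=> n; rewrite -[u n]fineK; last by near: n.
  rewrite lee_fin; apply: le_trans (ler_norm _) _.
  by near: n; exact: ucvg.
apply/fine_cvgP; split.
  apply: filterS (h 1 ltr01) => n un; rewrite ge0_fin_numE//.
  exact: le_lt_trans un (ltry _).
apply/cvgr0Pnorm_le => e e0; apply: filterS (h e e0) => n un /=.
rewrite ger0_norm ?fine_ge0// -lee_fin fineK// ge0_fin_numE//.
exact: le_lt_trans un (ltry _).
Unshelve. all: by end_near. Qed.

Section StronglyMeasurable.
Context {R : realType}.
Implicit Types E F : normedModType R.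
Notation mu := (@lebesgue_measure R).

Lemma strongly_measurable_eq E (I J : set R) (f g : R -> E) :
  I `<=` J -> {in I, f =1 g} -> strongly_measurable J f -> strongly_measurable I g.
Proof.
move=> IJ fg [s [hs sf]]; exists s; split=> // x Ix.
by rewrite -fg ?inE//; exact/sf/IJ.
Qed.

Lemma strongly_measurable_simple E I (s : seq (set R * E)) : is_simple s ->
  strongly_measurable I (simple_eval s).
Proof. by move=> hs; exists (fun=> s); split=> // x _; exact: cvg_cst. Qed.

Lemma strongly_measurableB E I (f g : R -> E) : strongly_measurable I f ->
  strongly_measurable I g -> strongly_measurable I (fun x => f x - g x).
Proof.
move=> [s [hs sf]] [s' [hs' sg]]; exists (fun n => simple_sub (s n) (s' n)).
split=> [n|x Ix]; first exact: is_simple_sub.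
under eq_fun do rewrite simple_eval_sub.
by apply: cvgB; [exact: sf|exact: sg].
Qed.

Lemma measurable_norm_strongly E (I : set R) (f : R -> E) : measurable I ->
  strongly_measurable I f -> measurable_fun I (fun x => `|f x| : R).
Proof.
move=> mI [s [hs sf]].
apply: (@measurable_fun_cvg _ _ _ _ (fun n x => `|simple_eval (s n) x| : R)).
- by move=> n; apply: measurable_funTS; exact: (measurable_simple_comp (fun e => `|e|)).
- by move=> x Ix; apply: cvg_norm; exact: sf.
Qed.

(** Each approximant is cut off to the set where its norm is at most [2 * |f x|]. Where [f x] is
    nonzero the cut is eventually inactive, because 2 > 1; where [f x = 0] it forces the value 0.
    The bound supplies the majorant for dominated convergence. *)
Lemma strongly_measurable_dominated E (I : set R) (f : R -> E) : measurable I ->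
  strongly_measurable I f ->
  exists s : nat -> seq (set R * E), [/\ forall n, is_simple (s n),
    forall x, I x -> simple_eval (s n) x @[n --> \oo] --> f x &
    forall n x, I x -> `|simple_eval (s n) x| <= 2 * `|f x|].
Proof.
move=> mI sf; have mf := measurable_norm_strongly mI sf; move: sf => [s [hs sf]].
pose C n := I `&` [set x | `|simple_eval (s n) x| <= 2 * `|f x|].
have mC n : measurable (C n).
  rewrite /C (_ : [set x | _] =
     (fun x => `|simple_eval (s n) x| <= 2 * `|f x|) @^-1` [set true])//.
  apply: (measurable_fun_ler _ _) => //.
    by apply: measurable_funTS; exact: (measurable_simple_comp (fun e => `|e|)).
  exact: measurable_funM.
have evC n x : I x -> `|simple_eval (simple_restrict (C n) (s n)) x| <= 2 * `|f x|.
  move=> Ix; rewrite simple_eval_restrict indicE.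
  have [/set_mem[_]|] := boolP (x \in C n); first by rewrite scale1r.
  by rewrite scale0r normr0 mulr_ge0.
exists (fun n => simple_restrict (C n) (s n)); split=> // [n|x Ix].
  exact: is_simple_restrict.
have [fx0|fx0] := eqVneq (f x) 0.
  have s0 n : simple_eval (simple_restrict (C n) (s n)) x = 0.
    by apply/eqP; rewrite -normr_le0 (le_trans (evC _ _ Ix))// fx0 normr0 mulr0.
  by rewrite fx0; under eq_fun do rewrite s0; exact: cvg_cst.
apply: cvg_trans (sf x Ix); apply: near_eq_cvg.
have fx : `|f x| < 2 * `|f x| by rewrite ltr_pMl ?normr_gt0// ltr1n.
near=> n; rewrite simple_eval_restrict indicE mem_set ?scale1r//; split=> //=.
by near: n; exact: cvgr_norm_le _ (sf x Ix) _ fx.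
Unshelve. all: by end_near. Qed.

End StronglyMeasurable.

Section Bochner.
Context {R : realType}.
Implicit Types E F : normedModType R.
Notation mu := (@lebesgue_measure R).

(** Working form of the definition: one simple function per tolerance. The tolerances 1/(n+1)
    recover a sequence. *)
Lemma is_bochner_integralP E (I : set R) (f : R -> E) (v : E) : measurable I ->
  is_bochner_integral I f v <-> strongly_measurable I f /\
  forall e : R, 0 < e -> exists s : seq (set R * E), [/\ is_simple s,
    (\int[mu]_(x in I) (`|f x - simple_eval s x|)%:E <= e%:E)%E &
    `|simple_integral I s - v| <= e].
Proof.
move=> mI; have i0 s : (0 <= \int[mu]_(x in I) (`|f x - simple_eval s x|)%:E)%E.
  exact: integral_EFin_ge0.
split=> [[sf [s [hs s0 sv]]]|[sf h]]; split=> //.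
  move=> e e0; have /cvge0_leP/(_ e e0) h1 := s0.
  have /cvgrPdist_le/(_ e e0) h2 := sv.
  have [N _ hN] := filterI (h1 (fun n => i0 (s n))) h2.
  have [? ?] := hN N (leqnn N); exists (s N); split => //.
  by rewrite distrC.
have /choice[s hs] : forall n, exists s : seq (set R * E), [/\ is_simple s,
    (\int[mu]_(x in I) (`|f x - simple_eval s x|)%:E <= (n.+1%:R^-1)%:E)%E &
    `|simple_integral I s - v| <= n.+1%:R^-1].
  by move=> n; apply: h; rewrite invr_gt0.
have small e : 0 < e -> \forall n \near \oo, (n.+1%:R^-1 : R) <= e.
  by move=> e0; near do apply/ltW; exact: near_infty_natSinv_lt (PosNum e0).
exists s; split=> [n||]; first by case: (hs n).
- apply/cvge0_leP => // e /small; apply: filterS => n ne.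
  by case: (hs n) => _ + _; move/le_trans; apply; rewrite lee_fin.
- apply/cvgrPdist_le => e /small; apply: filterS => n ne.
  by case: (hs n) => _ _; rewrite distrC; move/le_trans; exact.
Unshelve. all: by end_near. Qed.

Lemma is_bochner_integral_eq E (I : set R) (f g : R -> E) (v : E) : measurable I ->
  {in I, f =1 g} -> is_bochner_integral I f v -> is_bochner_integral I g v.
Proof.
move=> mI fg /(is_bochner_integralP _ _ mI)[sf hf].
apply/(is_bochner_integralP _ _ mI); split; first exact: strongly_measurable_eq sf.
move=> e /hf[s [hs s1 s2]]; exists s; split=> //; apply: le_trans s1.
rewrite le_eqVlt; apply/orP; left; apply/eqP.
by apply: eq_integral => x xI; rewrite fg.
Qed.

(** For a simple [s] close to [f], |v| is within e/2 of the norm of the integral of [s], and the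
    integral of |s| exceeds that of |f| by at most e/2. *)
Lemma bochner_integral_norm_le E (I : set R) (f : R -> E) v : measurable I ->
  (mu I < +oo)%E -> is_bochner_integral I f v ->
  (`|v|%:E <= \int[mu]_(x in I) (`|f x|)%:E)%E.
Proof.
move=> mI fI /(is_bochner_integralP _ _ mI)[sf h]; apply/lee_addgt0Pr => e e0.
have [s [hs s1 s2]] := h (e / 2) (divr_gt0 e0 (ltr0Sn _ 1)).
have -> : v = simple_integral I s - (simple_integral I s - v) by rewrite subKr.
apply: (@le_trans _ _ (`|simple_integral I s|%:E + (e / 2)%:E)%E).
  by rewrite -EFinD lee_fin (le_trans (ler_normB _ _))// lerD2l.
rewrite {2}(splitr e) EFinD addeA leeD2r//.
apply: le_trans (simple_integral_le hs mI fI) _.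
apply: le_trans (leeD2l _ s1).
have sfs := strongly_measurableB sf (strongly_measurable_simple I hs).
rewrite -integral_EFinD//; try exact: measurable_norm_strongly.
apply: le_integral_EFin => //.
- by apply: measurable_norm_strongly => //; exact: strongly_measurable_simple.
- by apply: measurable_funD; exact: measurable_norm_strongly.
- by move=> x Ix; rewrite -{1}(subKr (f x) (simple_eval s x)) ler_normB.
Qed.

Lemma is_bochner_integralB E (I : set R) (f g : R -> E) v w : measurable I ->
  is_bochner_integral I f v -> is_bochner_integral I g w ->
  is_bochner_integral I (fun x => f x - g x) (v - w).
Proof.
move=> mI /(is_bochner_integralP _ _ mI)[sf hf] /(is_bochner_integralP _ _ mI)[sg hg].
apply/(is_bochner_integralP _ _ mI); split; first exact: strongly_measurableB.
move=> e e0; have e20 : 0 < e / 2 by rewrite divr_gt0.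
have [s [hs s1 s2]] := hf _ e20; have [s' [hs' s'1 s'2]] := hg _ e20.
have sfs := strongly_measurableB sf (strongly_measurable_simple I hs).
have sgs := strongly_measurableB sg (strongly_measurable_simple I hs').
have sfg := strongly_measurableB (strongly_measurableB sf sg)
  (strongly_measurable_simple I (is_simple_sub hs hs')).
exists (simple_sub s s'); split; first exact: is_simple_sub.
  apply: (@le_trans _ _ (\int[mu]_(x in I)
      (`|f x - simple_eval s x| + `|g x - simple_eval s' x|)%:E)%E).
    apply: le_integral_EFin => //.
    - exact: (measurable_norm_strongly mI sfg).
    - by apply: measurable_funD; exact: measurable_norm_strongly.
    - move=> x Ix; rewrite simple_eval_sub.
      rewrite (_ : _ - (_ - _) = (f x - simple_eval s x) - (g x - simple_eval s' x)).
        exact: ler_normB.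
      by rewrite !opprB addrACA [RHS]addrACA; congr (_ + _); rewrite addrC.
  rewrite integral_EFinD//; try exact: measurable_norm_strongly.
  by rewrite (splitr e) EFinD leeD.
rewrite simple_integral_sub.
rewrite (_ : _ - _ - _ = (simple_integral I s - v) - (simple_integral I s' - w)).
  by rewrite (splitr e) (le_trans (ler_normB _ _))// lerD.
by rewrite !opprB addrACA [RHS]addrACA; congr (_ + _); rewrite addrC.
Qed.

Lemma is_bochner_integral_unique E (I : set R) (f : R -> E) v w : measurable I ->
  (mu I < +oo)%E -> is_bochner_integral I f v -> is_bochner_integral I f w -> v = w.
Proof.
move=> mI fI fv fw; have := is_bochner_integralB mI fv fw.
move/(bochner_integral_norm_le mI fI).
under eq_integral do rewrite subrr normr0.
by rewrite integral0 lee_fin normr_le0 subr_eq0 => /eqP.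
Qed.

Lemma bochner_integralE E (I : set R) (f : R -> E) v : measurable I ->
  (mu I < +oo)%E -> is_bochner_integral I f v -> bochner_integral I f = v.
Proof.
move=> mI fI fv; apply: xget_subset1 => // v1 v2 /=; exact: is_bochner_integral_unique.
Qed.

End Bochner.

(** * Powers of norms and approximation by simple functions in L^p *)

Section PowerNorm.
Context {R : realType}.

(** Away from 0 the power is differentiable; at 0 the radius [e^(1/p)] works. *)
Lemma continuous_norm_powR (p : R) : 0 < p -> continuous (fun x : R => `|x| `^ p).
Proof.
move=> p0 x; have [->|x0] := eqVneq x 0.
  apply/cvgrPdist_le => e e0; rewrite normr0 powR0 ?gt_eqF//.
  near=> t; rewrite sub0r normrN ger0_norm ?powR_ge0//.
  have tp : `|t| <= e `^ p^-1.
    by near: t; apply: (@nbhs0_le _ R^o); rewrite powR_gt0.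
  rewrite -[leRHS]powRr1; last exact: ltW.
  rewrite -(@mulVf _ p) ?gt_eqF// powRrM.
  by apply: ge0_ler_powR; rewrite ?nnegrE ?powR_ge0//; exact: ltW.
apply: (@continuous_comp _ _ _ (fun x : R => `|x|) (fun y => y `^ p)).
  exact: norm_continuous.
apply/differentiable_continuous/derivable1_diffP/derivable_powR.
by rewrite in_itv /= andbT normr_gt0.
Unshelve. all: by end_near. Qed.

(** The sum is at most twice the maximum, which gives the constant [2^p] without convexity. All
    later factors [2^q] originate here. *)
Lemma powR_normD_le (p a b : R) : 0 <= p -> 0 <= a -> 0 <= b ->
  (a + b) `^ p <= 2 `^ p * (a `^ p + b `^ p).
Proof.
move=> p0 a0 b0.
wlog ab : a b a0 b0 / a <= b.
  by move=> h; have [/h|/ltW/h] := leP a b; [exact|rewrite addrC [X in _ * X]addrC; exact].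
apply: (@le_trans _ _ ((2 * b) `^ p)).
  by apply: ge0_ler_powR; rewrite ?nnegrE ?addr_ge0 ?mulr_ge0//; lra.
by rewrite powRM// ler_pM2l ?powR_gt0// lerDr powR_ge0.
Qed.

End PowerNorm.

Section Approximation.
Context {R : realType}.
Implicit Types E F : normedModType R.
Notation mu := (@lebesgue_measure R).

Lemma dominated_powR_cvg E (I : set R) (f : R -> E) (s : nat -> seq (set R * E)) (p : R) :
  measurable I -> 0 < p -> strongly_measurable I f ->
  (\int[mu]_(x in I) (`|f x| `^ p)%:E < +oo)%E ->
  (forall n, is_simple (s n)) ->
  (forall x, I x -> simple_eval (s n) x @[n --> \oo] --> f x) ->
  (forall n x, I x -> `|simple_eval (s n) x| <= 2 * `|f x|) ->
  (\int[mu]_(x in I) (`|f x - simple_eval (s n) x| `^ p)%:E)%E @[n --> \oo] --> 0%E.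
Proof.
move=> mI p0 sf fp hs sfc sfd.
have mpow (g : R -> E) : strongly_measurable I g ->
    measurable_fun I (fun x => `|g x| `^ p).
  move=> sg; apply: (measurableT_comp (measurable_powR _)).
  exact: measurable_norm_strongly.
have sfs n := strongly_measurableB sf (strongly_measurable_simple I (hs n)).
(* The factor 3 in the majorant comes from |f - s_n| <= |f| + 2 |f|. *)
have := @dominated_cvg _ _ _ mu _ mI
  (fun n x => (`|f x - simple_eval (s n) x| `^ p)%:E) (cst 0%E)
  (fun x => (3 `^ p * `|f x| `^ p)%:E).
rewrite integral0; apply.
- by move=> n; apply/measurable_EFinP; exact: (mpow _ (sfs n)).
- move=> x Ix; apply: cvg_EFin; first exact: nearW.
  have := @cvg_comp _ _ _ (fun n => `|f x - simple_eval (s n) x| : R)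
    (fun y => `|y| `^ p) _ _ _ _ (@continuous_norm_powR R p p0 0).
  rewrite normr0 powR0 ?gt_eqF// => h.
  under eq_fun do rewrite -(normr_id (f x - _)).
  by apply: h; apply/norm_cvg0P; rewrite -(subrr (f x)); apply: cvgB;
    [exact: cvg_cst|exact: sfc].
- by [].
- apply/integrableP; split.
    by apply/measurable_EFinP/measurable_funM => //; exact: mpow.
  under eq_integral do rewrite gee0_abs ?lee_fin ?mulr_ge0 ?powR_ge0//.
  rewrite (@integral_EFinZ _ _ mI) ?powR_ge0//; last exact: mpow.
  by rewrite lte_mul_pinfty// ?lee_fin ?powR_ge0.
- move=> n x Ix; rewrite gee0_abs ?lee_fin ?powR_ge0//.
  rewrite -powRM//; apply: ge0_ler_powR; rewrite ?nnegrE ?(ltW p0) ?mulr_ge0//.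
  by rewrite (le_trans (ler_normB _ _))//; have := sfd n x Ix; lra.
Qed.

End Approximation.

Section BochnerExists.
Context {R : realType} {E : completeNormedModType R}.
Notation mu := (@lebesgue_measure R).

(** The dominated approximants converge to [f] in L^1 (the case p = 1 of [dominated_powR_cvg]), so
    their integrals form a Cauchy sequence in the complete space [E]. *)
Lemma is_bochner_integral_exists (I : set R) (f : R -> E) : measurable I ->
  (mu I < +oo)%E -> strongly_measurable I f ->
  (\int[mu]_(x in I) (`|f x|)%:E < +oo)%E ->
  exists v, is_bochner_integral I f v.
Proof.
move=> mI fI sf f1.
have [s [hs sfc sfd]] := strongly_measurable_dominated mI sf.
have s0 : (\int[mu]_(x in I) (`|f x - simple_eval (s n) x|)%:E)%E @[n --> \oo] --> 0%E.
  under eq_fun do under eq_integral do rewrite -[`|_|]powRr1//.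
  apply: dominated_powR_cvg => //.
  by under eq_integral do rewrite powRr1//.
suff : cvgn (fun n => simple_integral I (s n)).
  by move=> /cvg_ex[v hv]; exists v; split=> //; exists s.
have i0 n : (0 <= \int[mu]_(x in I) (`|f x - simple_eval (s n) x|)%:E)%E.
  exact: integral_EFin_ge0.
apply/cauchy_cvgP/cauchyP => e e0.
have e20 : 0 < e / 3 by rewrite divr_gt0.
have [N _ hN] := (cvge0_leP i0).1 s0 _ e20.
exists (simple_integral I (s N)); exists N => // n Nn.
rewrite -ball_normE /= -lte_fin -simple_integral_sub.
have fs n := strongly_measurableB sf (strongly_measurable_simple I (hs n)).
apply: le_lt_trans (simple_integral_le (is_simple_sub (hs N) (hs n)) mI fI) _.
apply: (@le_lt_trans _ _ (\int[mu]_(x in I)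
    (`|f x - simple_eval (s N) x| + `|f x - simple_eval (s n) x|)%:E)%E).
  apply: le_integral_EFin => //.
  - apply: measurable_norm_strongly => //.
    by apply: strongly_measurable_simple; exact: is_simple_sub.
  - by apply: measurable_funD; exact: measurable_norm_strongly.
  - move=> x Ix; rewrite simple_eval_sub [X in _ <= X + _]distrC.
    by rewrite (le_trans _ (ler_normD _ _))// addrA subrK.
rewrite integral_EFinD//; try exact: measurable_norm_strongly.
apply: (@le_lt_trans _ _ ((e / 3)%:E + (e / 3)%:E)%E).
  by rewrite leeD// hN//=.
by rewrite -EFinD lte_fin; lra.
Qed.

End BochnerExists.

(** * Translation and concatenation of integrals *)

Section Concatenation.
Context {R : realType}.
Implicit Types E F : normedModType R.
Notation mu := (@lebesgue_measure R).

(** By uniqueness of Lebesgue measure it is enough to compare the lengths of half-open intervals. *)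
Lemma lebesgue_measure_translation (a : R) (A : set R) : measurable A ->
  pushforward mu ((fun x => x + a) : _ -> measurableTypeR R) A = mu A.
Proof.
move=> mA; have mphi : measurable_fun setT (fun x : measurableTypeR R => x + a : measurableTypeR R).
  by apply: measurable_funD => //; exact: measurable_id.
pose phi : {mfun measurableTypeR R >-> measurableTypeR R} :=
  HB.pack (fun x : measurableTypeR R => x + a : measurableTypeR R)
    (isMeasurableFun.Build _ _ _ _ _ mphi).
apply/esym/(@lebesgue_measure_unique R (pushforward mu phi)) => // _ [[b c] _ <-].
transitivity (mu `]b - a, c - a]%classic); last first.
  congr (mu _); apply/seteqP; split=> x /=; by rewrite !in_itv /= ltrBlDr lerBrDr.
rewrite !lebesgue_measure_itv/= !lte_fin ltrD2r.
by case: ifP => // _; rewrite -!EFinB; congr (_%:E); ring.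
Qed.

Definition simple_shift E (t : R) (s : seq (set R * E)) : seq (set R * E) :=
  [seq ((fun x => x - t) @^-1` p.1, p.2) | p <- s].

Lemma measurable_shift (t : R) (A : set R) : measurable A ->
  measurable ((fun x => x - t) @^-1` A).
Proof.
move=> mA; rewrite -[X in measurable X]setTI; move: mA.
by apply: measurable_funB => //; exact: measurable_id.
Qed.

Lemma is_simple_shift E t (s : seq (set R * E)) : is_simple s -> is_simple (simple_shift t s).
Proof. by move=> hs p /mapP[p' /hs mp' ->]; exact: measurable_shift. Qed.

Lemma simple_eval_shift E t (s : seq (set R * E)) x :
  simple_eval (simple_shift t s) x = simple_eval s (x - t).
Proof. by rewrite /simple_eval big_map. Qed.

Lemma simple_integral_restrict E (I J : set R) (s : seq (set R * E)) : J `<=` I ->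
  simple_integral I (simple_restrict J s) = simple_integral J s.
Proof.
move=> JI; rewrite /simple_integral big_map; apply: eq_bigr => p _ /=.
by rewrite -setIA (setIidl JI).
Qed.

Lemma simple_integral_shift E (t : R) (I : set R) (s : seq (set R * E)) :
  measurable I -> is_simple s ->
  simple_integral ((fun x => x - t) @^-1` I) (simple_shift t s) = simple_integral I s.
Proof.
move=> mI hs; rewrite /simple_integral big_map; apply: eq_big_seq => p /hs mp /=.
rewrite -preimage_setI; congr (fine _ *: _).
exact: (lebesgue_measure_translation (- t) (measurableI _ _ mp mI)).
Qed.

(** Lets the second of two adjoining intervals drop its left end, which makes the pieces
    disjoint. *)
Lemma simple_integral_itv_oc E (t : R) (s : seq (set R * E)) : 0 <= t -> is_simple s ->
  simple_integral `]0, t]%classic s = simple_integral `[0, t]%classic s.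
Proof.
move=> t0 hs; apply: eq_big_seq => p /hs mp; congr (fine _ *: _).
rewrite -[X in _ = mu (_ `&` X)](@setU1itv _ R (BRight t) 0 false) ?bnd_simp// setIUr.
have m0 : mu (p.1 `&` [set 0]) = 0%E.
  apply/eqP; rewrite -measure_le0 -(lebesgue_measure_set1 (0 : R)).
  by apply: le_measure; rewrite ?inE//; exact: measurableI.
rewrite measureU; try exact: measurableI; first exact/esym/(etrans (congr1 (adde^~ _) m0))/add0e.
apply/seteqP; split=> // x [[_ /= ->] [_]] /=.
by rewrite in_itv /= ltxx.
Qed.

Lemma integral_shift (t : R) (I : set R) (f : R -> R) : measurable I ->
  measurable_fun I f -> (forall x, I x -> 0 <= f x) ->
  (\int[mu]_(x in (fun x => x - t)%R @^-1` I) (f (x - t))%:E =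
    \int[mu]_(x in I) (f x)%:E)%E.
Proof.
move=> mI mf f0.
have mphi : measurable_fun setT (fun x : measurableTypeR R => x - t : measurableTypeR R).
  by apply: measurable_funB => //; exact: measurable_id.
have := @ge0_integral_pushforward _ _ (measurableTypeR R) (measurableTypeR R) R
  (fun x => x - t) mphi mu I (EFin \o f) mI.
rewrite /= => <-; last 2 first.
- exact/measurable_EFinP.
- by move=> y; rewrite inE lee_fin => /f0.
by apply: eq_measure_integral => A mA _; exact: (lebesgue_measure_translation (- t) mA).
Qed.

(** The integral form of the cocycle law: on the first interval the integrand is the image under an
    operator [L], which leaves the integral; on the second it is a translate. Simple approximants of
    [f] and [g] are transported in the same way and glued. *)
Lemma is_bochner_integral_concat E F (L : E -> F) (M t h : R) (f : R -> E)
    (g G : R -> F) v w : 0 <= t -> 0 <= h -> 0 <= M ->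
  linear L -> (forall x, `|L x| <= M * `|x|) ->
  is_bochner_integral `[0, t] f v -> is_bochner_integral `[0, h] g w ->
  strongly_measurable `[0, t + h] G ->
  (forall s, 0 <= s <= t -> G s = L (f s)) ->
  (forall s, t < s <= t + h -> G s = g (s - t)) ->
  is_bochner_integral `[0, t + h] G (L v + w).
Proof.
move=> t0 h0 M0 lL LM.
have mt : measurable `[0, t]%classic by exact: measurable_itv.
have mh : measurable `[0, h]%classic by exact: measurable_itv.
have mth : measurable `[0, t + h]%classic by exact: measurable_itv.
move=> /(is_bochner_integralP _ _ mt)[sf hf] /(is_bochner_integralP _ _ mh)[sg hg] sG Gf Gg.
apply/(is_bochner_integralP _ _ mth); split=> // e e0.
(* Dividing by [M + 1] instead of [M] covers [M = 0]. *)
have e10 : 0 < e / 2 / (M + 1) by rewrite !divr_gt0//; lra.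
have e20 : 0 < e / 2 by rewrite divr_gt0.
have Me : M * (e / 2 / (M + 1)) <= e / 2.
  by rewrite mulrCA ger_pMr// ler_pdivrMr; lra.
have [s [hs s1 s2]] := hf _ e10; have [r [hr r1 r2]] := hg _ e20.
(* The point [t] belongs to the first piece only, as in the hypotheses on [G]. *)
pose s' := simple_restrict `[0, t]%classic s.
pose r' := simple_restrict `]0, h]%classic r.
have hs' : is_simple s' by apply: is_simple_restrict.
have hr' : is_simple r' by apply: is_simple_restrict.
pose z := simple_map L s' ++ simple_shift t r'.
have hz : is_simple z.
  by apply: is_simple_cat; [exact: is_simple_map|exact: is_simple_shift].
have zt x : 0 <= x <= t -> simple_eval z x = L (simple_eval s x).
  move=> /andP[x0 xt]; rewrite simple_eval_cat simple_eval_map// simple_eval_shift.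
  rewrite !simple_eval_restrict !indicE mem_set ?memNset ?scale1r ?scale0r ?addr0//=.
    by rewrite in_itv /= ltNge subr_le0 xt.
  by rewrite in_itv /= x0.
have zh x : t < x <= t + h -> simple_eval z x = simple_eval r (x - t).
  move=> /andP[tx xh]; rewrite simple_eval_cat simple_eval_map// simple_eval_shift.
  rewrite !simple_eval_restrict !indicE memNset ?mem_set ?scale1r ?scale0r ?(linear_prop0 lL) ?add0r//=.
    by rewrite in_itv /= subr_gt0 tx lerBlDl.
  by rewrite in_itv /= [x <= t]leNgt tx andbF.
have sGz := strongly_measurableB sG (strongly_measurable_simple `[0, t + h] hz).
have sfs := strongly_measurableB sf (strongly_measurable_simple `[0, t] hs).
have sgr := strongly_measurableB sg (strongly_measurable_simple `[0, h] hr).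
have splitI : `[0, t + h]%classic = `[0, t] `|` (fun x => x - t) @^-1` `]0, h].
  apply/seteqP; split=> x /=; rewrite !in_itv /= ?subr_gt0 ?lerBlDl.
    by move=> /andP[x0 xth]; have [xt|xt] := leP x t; [left; rewrite x0|right].
  by move=> [/andP[-> xt]|/andP[tx ->]]/=; rewrite ?andbT; lra.
have mh' : measurable `]0, h]%classic by exact: measurable_itv.
have mh'' := measurable_shift t mh'.
exists z; split=> //.
  have mGz := measurable_norm_strongly mth sGz.
  rewrite {1}splitI ge0_integral_setU//; last 2 first.
  - by rewrite -splitI; exact/measurable_EFinP.
  - rewrite disj_set2E; apply/eqP/seteqP; split=> // x [] /=.
    by rewrite !in_itv /= subr_gt0 => /andP[_ xt] /andP[/lt_geF]; rewrite xt.
  rewrite (splitr e) EFinD; apply: leeD.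
    apply: (@le_trans _ _ (\int[mu]_(x in `[0%R, t]) (M * `|f x - simple_eval s x|)%:E)%E).
      apply: le_integral_EFin => //.
      - apply: measurable_funS mGz => //.
        by rewrite splitI; exact: subsetUl.
      - by apply: measurable_funM => //; exact: measurable_norm_strongly.
      - move=> x /=; rewrite in_itv /= => x0t.
        by rewrite Gf// zt// -(linear_propB lL).
    rewrite integral_EFinZ//; last exact: measurable_norm_strongly.
    apply: (@le_trans _ _ (M%:E * (e / 2 / (M + 1))%:E)%E).
      by rewrite lee_wpmul2l ?lee_fin.
    by rewrite -EFinM lee_fin.
  rewrite (_ : integral _ _ _ = \int[mu]_(x in (fun x => x - t)%R @^-1` `]0%R, h])
      (`|g (x - t) - simple_eval r (x - t)|)%:E)%E; last first.
    apply: eq_integral => x; rewrite inE /= in_itv /= subr_gt0 lerBlDl => xth.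
    by rewrite Gg// zh.
  have mgr := measurable_norm_strongly mh sgr.
  rewrite (@integral_shift t _ (fun x => `|g x - simple_eval r x|))//; last first.
    by apply: measurable_funS mgr => //; apply: subset_itv; rewrite ?bnd_simp.
  apply: le_trans r1; apply: ge0_subset_integral => //.
    exact/measurable_EFinP.
  by apply: subset_itv; rewrite ?bnd_simp.
have -> : simple_integral `[0, t + h] z =
    L (simple_integral `[0, t] s) + simple_integral `[0, h] r.
  rewrite simple_integral_cat simple_integral_map// simple_integral_restrict; last first.
    by rewrite splitI; exact: subsetUl.
  congr (_ + _); rewrite -simple_integral_itv_oc//.
  rewrite -(simple_integral_shift t mh' hr).
  have -> : simple_shift t r' = simple_restrict ((fun x => x - t) @^-1` `]0, h]) (simple_shift t r).
    by rewrite /simple_shift /simple_restrict -!map_comp.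
  rewrite simple_integral_restrict//.
  by rewrite splitI; exact: subsetUr.
rewrite opprD addrACA -(linear_propB lL) (splitr e).
apply: le_trans (ler_normD _ _) _; apply: lerD => //.
apply: le_trans (LM _) _; apply: le_trans Me.
by rewrite ler_wpM2l.
Qed.

End Concatenation.

(** * Strong measurability and density of continuous functions *)

Section Grid.
Context {R : realType}.
Implicit Types E F : normedModType R.

(* Freezing the first argument of [G] at the left end of each cell of a uniform
   grid turns [G s (u s)] into a simple function; only limits from the left in
   the first argument are then involved. *)
Lemma strongly_measurable_parametric E F (t : R) (u : R -> E) (G : R -> E -> F) :
  (forall r, 0 <= r <= t -> linear (G r)) ->
  (forall (s : R) (r : nat -> R) (e : nat -> E), 0 <= s <= t ->
     (forall n, 0 <= r n <= s) -> r @ \oo --> s -> e @ \oo --> u s ->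
     G (r n) (e n) @[n --> \oo] --> G s (u s)) ->
  strongly_measurable `[0, t] u ->
  strongly_measurable `[0, t] (fun s => G s (u s)).
Proof.
move=> lG cG [z [hz zu]].
pose node n k : R := k%:R / n.+1%:R.
(* The successor includes the cell that contains [t] itself; all nodes used still lie in [[0, t]],
   where [G] is linear. *)
pose K n := (Num.truncn (t * n.+1%:R)).+1.
pose cell n k : set R := `[node n k, node n k.+1[%classic.
pose y n := flatten [seq simple_map (G (node n k)) (simple_restrict (cell n k) (z n))
  | k <- iota 0 (K n)].
have nodeE n x : 0 <= x -> x \in cell n (Num.truncn (x * n.+1%:R)).
  move=> x0; rewrite inE /cell /node /= in_itv /= ler_pdivrMr// ltr_pdivlMr//.
  by rewrite truncn_le ?truncnS_gt// mulr_ge0.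
have nodele n k x : x \in cell n k -> 0 <= x -> Num.truncn (x * n.+1%:R) = k.
  rewrite inE /cell /node /= in_itv /= ler_pdivrMr// ltr_pdivlMr// => /andP[a b] x0.
  by apply/eqP; rewrite truncn_eq ?mulr_ge0// a.
exists y; split=> [n|x]; last first.
  rewrite /= in_itv /= => /andP[x0 xt].
  pose r n := node n (Num.truncn (x * n.+1%:R)).
  have r0 n : 0 <= r n <= x.
    rewrite divr_ge0//=; have := nodeE n x x0.
    by rewrite inE /cell /= in_itv /= => /andP[].
  have rx : r @ \oo --> x.
    apply/cvgrPdist_le => e e0; near=> n.
    have := nodeE n x x0; rewrite inE /cell /= in_itv /= -/(r n) => /andP[rn1 rn2].
    rewrite ger0_norm ?subr_ge0//.
    apply: (@le_trans _ _ n.+1%:R^-1).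
      by rewrite lerBlDl ltW// (lt_le_trans rn2)// /r /node -natr1 mulrDl mul1r.
    by near: n; near=> n; apply/ltW; near: n; exact: near_infty_natSinv_lt (PosNum e0).
  suff yE n : simple_eval (y n) x = G (r n) (simple_eval (z n) x).
    by under eq_fun do rewrite yE; apply: cG; rewrite ?x0// => //; apply: zu; rewrite /= in_itv /= x0.
  have kK : Num.truncn (x * n.+1%:R) \in iota 0 (K n).
    rewrite mem_iota /= add0n ltnS; apply: le_truncn.
    by rewrite ler_wpM2r.
  have lGk k : k \in iota 0 (K n) -> linear (G (node n k)).
    rewrite mem_iota /= add0n ltnS => kt; apply: lG.
    have t0 := le_trans x0 xt.
    rewrite divr_ge0//= ler_pdivrMr//.
    by rewrite -truncn_ge_nat ?mulr_ge0.
  rewrite /simple_eval big_flatten big_map (bigD1_seq _ kK) ?iota_uniq//=.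
  rewrite -/(simple_eval _ _) simple_eval_map; last exact: lGk.
  rewrite simple_eval_restrict indicE nodeE// scale1r -/(r n).
  rewrite big1_seq ?addr0// => k /andP[kx kI].
  rewrite -/(simple_eval _ _) simple_eval_map; last exact: lGk.
  rewrite simple_eval_restrict indicE; case: (boolP (x \in cell n k)) => [xc|_].
    by move: kx; rewrite (nodele _ _ _ xc x0) eqxx.
  by rewrite scale0r (linear_prop0 (lGk _ kI)).
move=> p /flatten_mapP[k _].
by apply: (is_simple_map (is_simple_restrict _ (hz n))); exact: measurable_itv.
Unshelve. all: by end_near. Qed.

(** The grid lemma for the constant scalar input 1 and the maps [a |-> a *: f s]. *)
Lemma strongly_measurable_continuous E (t : R) (f : R -> E) : continuous f ->
  strongly_measurable `[0, t] f.
Proof.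
move=> cf.
apply: (@strongly_measurable_eq _ _ _ `[0, t] (fun s => (1 : R) *: f s)) => //.
  by move=> x _ /=; rewrite scale1r.
apply: (@strongly_measurable_parametric R^o E t (fun=> 1) (fun s a => a *: f s)).
- by move=> r _ a x y; rewrite scalerDl scalerA.
- move=> s r e s0 r0 rs e1; apply: (cvgZ e1).
  exact: (cvg_comp _ _ rs (cf s)).
- pose z : seq (set R * R^o) := [:: (setT, 1)].
  have hz : is_simple z by move=> p; rewrite inE => /eqP ->; exact: measurableT.
  apply: strongly_measurable_eq (strongly_measurable_simple `[0, t] hz) => // x _.
  by rewrite /simple_eval big_seq1 /= indicT [LHS]mulr1.
Qed.

End Grid.

Section Density.
Context {R : realType}.
Notation mu := (@lebesgue_measure R).

Lemma lebesgue_measure_itv_cc_lty (a b : R) : (mu `[a, b]%classic < +oo)%E.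
Proof. by rewrite lebesgue_measure_itv /=; case: ifP => // _; rewrite -EFinB ltry. Qed.

(** A continuous L^1 approximant is clamped to [0, 1]. As the indicator takes values in {0, 1},
    clamping does not increase the distance to it and keeps this distance at most 1. *)
Lemma indic_continuous_approx (t e : R) (A : set R) : measurable A -> 0 < e ->
  exists h : R -> R, [/\ continuous h, forall x, `|\1_A x - h x| <= 1 &
    (\int[mu]_(x in `[0%R, t]) (`|\1_A x - h x|)%:E <= e%:E)%E].
Proof.
move=> mA e0.
have mI : measurable `[0, t]%classic by exact: measurable_itv.
have fI : (mu `[0%R, t]%classic < +oo)%E.
  exact: lebesgue_measure_itv_cc_lty.
have iA : mu.-integrable `[0, t] (EFin \o (\1_A : R -> R)).
  apply: measurable_bounded_integrable => //; exists 1; split=> // M M1 y _ /=.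
  rewrite (le_trans _ (ltW M1))// indicE; case: (y \in A); rewrite ?normr1 ?normr0//.
have [g [cg ig g0]] := approximation_continuous_integrable mI fI iA.
have [N _ hN] := (cvge0_leP (fun n => integral_ge0 _ (fun x _ => abse_ge0 _))).1 g0 _ e0.
pose h x := Num.max 0 (Num.min 1 (g N x)).
have ch : continuous h.
  move=> x; apply: (@continuous_max _ _ (cst 0) (fun x => Num.min 1 (g N x))); first exact: cst_continuous.
  by apply: (@continuous_min _ _ (cst 1) (g N)); [exact: cst_continuous|exact: cg].
exists h; split=> //.
  move=> x; rewrite /h indicE ler_norml; case: (x \in A) => /=.
    by rewrite /Num.max /Num.min; case: ifP; case: ifP; lra.
  by rewrite /Num.max /Num.min; case: ifP; case: ifP; lra.
apply: le_trans (hN N (leqnn N)); apply: le_integral_EFin => //.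
- by apply: measurable_funTS; apply: measurableT_comp => //;
   apply: measurable_funB => //; exact: continuous_measurable_fun.
- by apply: measurable_funTS; apply: measurableT_comp => //;
   apply: measurable_funB => //; exact: continuous_measurable_fun.
move=> x _; rewrite /h indicE ler_norml.
have := ler_norm ((x \in A)%:R - g N x); have := ler_norm (g N x - (x \in A)%:R).
rewrite distrC; case: (x \in A) => /=; move: (`|_|) => z.
  by case: (leP 1 (g N x)) => ?; [case: (leP 0 1) => ?|case: (leP 0 (g N x)) => ?]; lra.
by case: (leP 1 (g N x)) => ?; [case: (leP 0 1) => ?|case: (leP 0 (g N x)) => ?]; lra.
Qed.

(** The uniform bound, which does not depend on [e], is what later upgrades the L^1 estimate to L^p:
    if |y| <= C then |y|^p <= C^(p-1) |y|. *)
Lemma simple_continuous_approx (E : normedModType R) (t e : R) (s : seq (set R * E)) :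
  is_simple s -> 0 < e -> exists w : R -> E, [/\ continuous w,
    forall x, `|simple_eval s x - w x| <= \sum_(p <- s) `|p.2| &
    (\int[mu]_(x in `[0%R, t]) (`|simple_eval s x - w x|)%:E <= e%:E)%E].
Proof.
have mI : measurable `[0, t]%classic by exact: measurable_itv.
elim: s e => [|p s IH] e hs e0.
  exists (fun=> 0); split; first by move=> x; exact: cst_continuous.
    by move=> x; rewrite /simple_eval !big_nil subrr normr0.
  under eq_integral do rewrite /simple_eval big_nil subrr normr0.
  by rewrite integral0 lee_fin ltW.
have /is_simple_cons[mp hs'] := hs.
have e20 : 0 < e / 2 by rewrite divr_gt0.
have [w [cw ws wi]] := IH _ hs' e20.
have e30 : 0 < e / 2 / (`|p.2| + 1) by rewrite !divr_gt0// ltr_wpDl.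
have [h [ch hp hi]] := indic_continuous_approx t mp e30.
have cw' : continuous (fun x => h x *: p.2 + w x).
  by move=> x; apply: cvgD; [apply: cvgZr_tmp; exact: ch|exact: cw].
exists (fun x => h x *: p.2 + w x); split=> //.
  move=> x; rewrite simple_eval_cons big_cons opprD addrACA -scalerBl.
  rewrite (le_trans (ler_normD _ _))// lerD//.
  by rewrite normrZ ler_piMl.
have hw : strongly_measurable `[0, t] (fun x => simple_eval s x - w x).
  apply: strongly_measurableB; first exact: strongly_measurable_simple.
  exact: strongly_measurable_continuous.
have hw' : strongly_measurable `[0, t] (fun x => simple_eval (p :: s) x - (h x *: p.2 + w x)).
  apply: strongly_measurableB; first exact: strongly_measurable_simple.
  exact: strongly_measurable_continuous.
have mh : measurable_fun `[0, t] (fun x => `|\1_(p.1) x - h x|).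
  by apply: measurable_funTS; apply: measurableT_comp => //;
    apply: measurable_funB => //; exact: continuous_measurable_fun.
apply: (@le_trans _ _ (\int[mu]_(x in `[0%R, t])
   (`|p.2| * `|\1_(p.1) x - h x| + `|simple_eval s x - w x|)%:E)%E).
  apply: le_integral_EFin => //.
  - exact: (measurable_norm_strongly mI hw').
  - apply: measurable_funD; first exact: measurable_funM.
    exact: measurable_norm_strongly.
  - move=> x _; rewrite simple_eval_cons opprD addrACA -scalerBl.
    by rewrite (le_trans (ler_normD _ _))// normrZ mulrC.
rewrite integral_EFinD//; try exact: measurable_norm_strongly; last first.
  exact: measurable_funM.
rewrite integral_EFinZ// (splitr e) EFinD leeD//.
apply: (@le_trans _ _ (`|p.2|%:E * (e / 2 / (`|p.2| + 1))%:E)%E).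
  by rewrite lee_wpmul2l ?lee_fin.
rewrite -EFinM lee_fin mulrCA ger_pMr// ler_pdivrMr ?ltr_wpDl//.
by rewrite mul1r lerDl.
Qed.

(** One approximant serves both norms: the L^p error enters the energy estimate, the L^1 error
    controls [Phi]. Finiteness in L^1 follows from |u| <= 1 + |u|^p on the bounded interval. *)
Lemma continuous_dense_Lp (E : normedModType R) (t p e : R) (u : R -> E) :
  1 <= p -> 0 <= t -> 0 < e -> strongly_measurable `[0, t] u ->
  (\int[mu]_(x in `[0%R, t]) (`|u x| `^ p)%:E < +oo)%E ->
  exists w : R -> E, [/\ continuous w,
    (\int[mu]_(x in `[0%R, t]) (`|u x - w x| `^ p)%:E <= e%:E)%E &
    (\int[mu]_(x in `[0%R, t]) (`|u x - w x|)%:E <= e%:E)%E].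
Proof.
move=> p1 t0 e0 su up.
have mI : measurable `[0, t]%classic by exact: measurable_itv.
have p0 : 0 < p by lra.
have [s [hs sc sd]] := strongly_measurable_dominated mI su.
have mpow (g : R -> E) : strongly_measurable `[0, t] g ->
    measurable_fun `[0, t] (fun x => `|g x| `^ p).
  move=> sg; apply: (measurableT_comp (measurable_powR _)).
  exact: measurable_norm_strongly.
have u1 : (\int[mu]_(x in `[0%R, t]) (`|u x|)%:E < +oo)%E.
  apply: (@le_lt_trans _ _ (\int[mu]_(x in `[0%R, t]) (1 + `|u x| `^ p)%:E)%E).
    apply: le_integral_EFin => //.
    - exact: measurable_norm_strongly.
    - by apply: measurable_funD => //; exact: mpow.
    - move=> x _; have [ux|ux] := leP `|u x| 1.
        by rewrite (le_trans ux)// lerDl powR_ge0.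
      by rewrite (le_trans (le1r_powR (ltW ux) p1))// lerDr.
  rewrite integral_EFinD//; last exact: mpow.
  by rewrite lte_add_pinfty// integral_cst// mul1e lebesgue_measure_itv_cc_lty.
have e10 : 0 < e / 2 by rewrite divr_gt0.
have e20 : 0 < e / 2 / 2 `^ p by rewrite divr_gt0// powR_gt0.
have sp := dominated_powR_cvg mI p0 su up hs sc sd.
have s1 : (\int[mu]_(x in `[0%R, t]) (`|u x - simple_eval (s n) x|)%:E)%E @[n --> \oo] --> 0%E.
  under eq_fun do under eq_integral do rewrite -[`|_|]powRr1//.
  apply: dominated_powR_cvg => //.
  by under eq_integral do rewrite powRr1//.
have ip0 n : (0 <= \int[mu]_(x in `[0%R, t]) (`|u x - simple_eval (s n) x| `^ p)%:E)%E.
  by apply: integral_EFin_ge0 => x _; exact: powR_ge0.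
have i10 n : (0 <= \int[mu]_(x in `[0%R, t]) (`|u x - simple_eval (s n) x|)%:E)%E.
  exact: integral_EFin_ge0.
have [N _ hN] := filterI ((cvge0_leP ip0).1 sp _ e20) ((cvge0_leP i10).1 s1 _ e10).
have [hNp hN1] := hN N (leqnn N).
(* The summand 1 makes [C] positive, since a power of it is a divisor in the tolerance below. That
   tolerance has one entry for the L^1 error and one for the L^p error; the latter gives [e / 2]
   after multiplication by [2^p * C^(p-1)]. *)
pose C := \sum_(p <- s N) `|p.2| + 1.
have C0 : 0 < C by rewrite ltr_wpDl// sumr_ge0.
have e30 : 0 < Num.min (e / 2) (e / 2 / 2 `^ p / C `^ (p - 1)).
  by rewrite lt_min e10 divr_gt0// powR_gt0.
have [w [cw ws wi]] := simple_continuous_approx t (hs N) e30.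
have sN := strongly_measurable_simple `[0, t] (hs N).
have sw := strongly_measurable_continuous t cw.
have suN := strongly_measurableB su sN.
have sNw := strongly_measurableB sN sw.
have suw := strongly_measurableB su sw.
exists w; split=> //.
  apply: (@le_trans _ _ (\int[mu]_(x in `[0%R, t]) (2 `^ p * (`|u x - simple_eval (s N) x| `^ p)
      + 2 `^ p * C `^ (p - 1) * `|simple_eval (s N) x - w x|)%:E)%E).
    apply: le_integral_EFin => //.
    - exact: (mpow _ suw).
    - apply: measurable_funD; apply: measurable_funM => //; first exact: mpow.
      exact: measurable_norm_strongly.
    - move=> x _; rewrite -(subrKA (simple_eval (s N) x) (u x)).
      apply: (@le_trans _ _ ((`|u x - simple_eval (s N) x| + `|simple_eval (s N) x - w x|) `^ p)).
        by apply: ge0_ler_powR; rewrite ?nnegrE ?(ltW p0)// ?addr_ge0// ler_normD.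
      apply: le_trans (powR_normD_le _ _ _) _ => //; first exact: ltW.
      rewrite mulrDr lerD2l -mulrA ler_wpM2l ?powR_ge0//.
      rewrite -mulr_powRB1// mulrC ler_wpM2r//.
      apply: ge0_ler_powR; rewrite ?nnegrE ?subr_ge0 ?(ltW C0)//.
      by rewrite (le_trans (ws x))// lerDl.
  rewrite integral_EFinD//;
    try by [apply: measurable_funM => //; exact: mpow
           |apply: measurable_funM => //; exact: measurable_norm_strongly
           |move=> x _; rewrite !mulr_ge0 ?powR_ge0].
  rewrite !integral_EFinZ ?mulr_ge0 ?powR_ge0//;
    try by [exact: mpow|exact: measurable_norm_strongly].
  rewrite (splitr e) EFinD; apply: leeD.
    apply: (@le_trans _ _ ((2 `^ p)%:E * (e / 2 / 2 `^ p)%:E)%E).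
      by rewrite lee_wpmul2l ?lee_fin ?powR_ge0.
    by rewrite -EFinM lee_fin mulrCA divff ?mulr1// gt_eqF// powR_gt0.
  apply: (@le_trans _ _ ((2 `^ p * C `^ (p - 1))%:E * (e / 2 / 2 `^ p / C `^ (p - 1))%:E)%E).
    rewrite lee_wpmul2l ?lee_fin ?mulr_ge0 ?powR_ge0//.
    by rewrite (le_trans wi)// lee_fin ge_min lexx orbT.
  rewrite -EFinM lee_fin.
  have : 2 `^ p != 0 :> R by rewrite gt_eqF// powR_gt0.
  have : C `^ (p - 1) != 0 :> R by rewrite gt_eqF// powR_gt0.
  move: (2 `^ p) (C `^ (p - 1)) => a b b0 a0.
  by rewrite le_eqVlt; apply/orP; left; apply/eqP; field; rewrite ?a0 ?b0.
apply: (@le_trans _ _ (\int[mu]_(x in `[0%R, t])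
   (`|u x - simple_eval (s N) x| + `|simple_eval (s N) x - w x|)%:E)%E).
  apply: le_integral_EFin => //.
  - exact: measurable_norm_strongly.
  - by apply: measurable_funD; exact: measurable_norm_strongly.
  - by move=> x _; rewrite -(subrKA (simple_eval (s N) x) (u x)) ler_normD.
rewrite integral_EFinD//; try exact: measurable_norm_strongly.
rewrite (splitr e) EFinD leeD//.
by rewrite (le_trans wi)// lee_fin ge_min lexx.
Qed.

End Density.

(** * Semigroups and the input map *)

Section SemigroupBound.
Context {R : realType}.

Lemma at_rightP (P : R -> Prop) : (\forall t \near 0^'+, P t) ->
  exists2 d : R, 0 < d & forall t, 0 < t < d -> P t.
Proof.
move=> [d /= d0 h]; exists d => // t /andP[t0 td]; apply: h => //=.
by rewrite sub0r normrN gtr0_norm.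
Qed.

Lemma bounded_operator_le (E F : normedModType R) (f : E -> F) :
  bounded_operator f -> exists2 M, 0 <= M & forall x, `|f x| <= M * `|x|.
Proof.
move=> [lf cf]; pose f' : {linear E -> F} := HB.pack f (GRing.isLinear.Build _ _ _ _ _ lf).
have /linear_boundedP := continuous_linear_bounded (0 : E) (cf 0 : {for 0, continuous f'}).
by move=> /pinfty_ex_gt0[M M0 hM]; exists M => //; exact: ltW.
Qed.

(** A bound on some short interval suffices: composing finitely many short steps reaches [tau]. *)
Lemma C0_semigroup_bound (E : completeNormedModType R) (T : R -> E -> E) (tau : R) :
  C0_semigroup T ->
  exists2 M, 0 <= M & forall s x, 0 <= s <= tau -> `|T s x| <= M * `|x|.
Proof.
move=> [Tb T0 TD Tc].
pose bd d M := forall s x, 0 <= s <= d -> `|T s x| <= M * `|x|.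
suff [d d0 [M M0 hM]] : exists2 d, 0 < d & exists2 M, 0 <= M & bd d M.
  have step n : exists2 M, 0 <= M & bd (n%:R * d) M.
    elim: n => [|n [N N0 hN]].
      by exists M => // s x /andP[s0]; rewrite mul0r => s1; apply: hM; rewrite s0 (le_trans s1)// ltW.
    (* [M * N] bounds the new step and [N] the earlier times; the sum covers both, whether or not
       [M] is at least 1. *)
    exists (M * N + N); first by rewrite addr_ge0 ?mulr_ge0.
    move=> s x /andP[s0]; rewrite -natr1 mulrDl mul1r => sd.
    have [sn|sn] := leP s (n%:R * d).
      by rewrite (le_trans (hN _ _ _)) ?s0// ler_wpM2r// lerDr mulr_ge0.
    have nd0 : 0 <= n%:R * d by rewrite mulr_ge0// ltW.
    rewrite -(subrK (n%:R * d) s) TD ?subr_ge0 ?(ltW sn)//.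
    apply: (le_trans (hM _ _ _)); first by rewrite subr_ge0 ltW//= lerBlDl.
    rewrite mulrDl -mulrA ler_wpDr ?mulr_ge0// ler_wpM2l//.
    by apply: hN; rewrite nd0 lexx.
  have [N N0 hN] := step (Num.truncn (tau / d)).+1.
  exists N => // s x /andP[s0 st]; apply: hN; rewrite s0 (le_trans st)//.
  by rewrite -ler_pdivrMr// ltW// truncnS_gt.
(* Otherwise the bound fails along times tending to 0, where strong continuity
   makes the operators pointwise bounded: this contradicts Banach-Steinhaus. *)
apply: contrapT => nex.
have /choice[sx hsx] : forall n : nat, exists sx : R * E,
    0 <= sx.1 <= n.+1%:R^-1 /\ n%:R * `|sx.2| < `|T sx.1 sx.2|.
  move=> n; apply: contrapT => nsx; apply: nex.
  exists n.+1%:R^-1; first by rewrite invr_gt0.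
  exists n%:R => // s x s01; rewrite leNgt; apply/negP => h.
  by apply: nsx; exists (s, x).
pose F := range (fun n => T (sx n).1).
have bF : forall f, F f -> bounded_fun_norm f /\ linear f.
  move=> _ [n _ <-]; have [[/andP[s0 _] _]] := (hsx n).
  have bT := Tb _ s0; split; last by case: bT.
  have [M M0 hM] := bounded_operator_le bT.
  by move=> r; exists (M * r) => x xr; rewrite (le_trans (hM x))// ler_wpM2l.
have pF : pointwise_bounded F.
  move=> x; have /cvgrPdist_le/(_ 1 ltr01)/at_rightP[d d0 hd] := Tc x.
  have [N _ hN] := near_infty_natSinv_lt (PosNum d0).
  (* From index [N] on the times are below [d], where T x stays within 1 of [x]; the sum takes care
     of the finitely many others. *)
  exists (1 + `|x| + \sum_(k < N) `|T (sx k).1 x|) => _ [n _ <-].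
  have [nN|nN] := ltnP n N.
    rewrite (bigD1 (Ordinal nN))//= addrCA lerDl !addr_ge0// sumr_ge0//.
  apply: (@le_trans _ _ (1 + `|x|)); last by rewrite lerDl sumr_ge0.
  have [/andP[]] := (hsx n).1; rewrite le_eqVlt => /predU1P[<- _|sn0 sn1].
    by rewrite T0 lerDr.
  rewrite -(subrK x (T _ x)) (le_trans (ler_normD _ _))// lerD2r distrC hd//.
  by rewrite sn0 (le_lt_trans sn1)// hN.
have [M hM] := Banach_Steinhauss bF pF 1.
have [[/andP[s0 _]]] := hsx (Num.truncn M).+1.
set n := (_).+1; set s := (sx n).1; set x := (sx n).2 => hsn.
have x0 : 0 < `|x|.
  rewrite normr_gt0; apply/eqP => x0; move: hsn.
  by rewrite x0 (linear_prop0 (Tb _ s0).1) normr0 mulr0 ltxx.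
have := hM (T s) (ex_intro2 _ _ n I erefl) (`|x|^-1 *: x).
rewrite (linear_propZ (Tb _ s0).1) !normrZ normfV normr_id mulVf ?gt_eqF// => /(_ (lexx _)).
rewrite ler_pdivrMl// mulrC => h; have := lt_le_trans hsn h.
rewrite ltr_pM2r// => nM; have := truncnS_gt M.
by rewrite ltNge (ltW nM).
Qed.

(** Since tau - r n = (tau - s) + (s - r n) with s - r n >= 0, the operator [T (tau - s)] factors
    out, and right continuity at time 0 is enough. The uniform bound handles the varying vectors
    [e n]. *)
Lemma C0_semigroup_left_cvg (E : completeNormedModType R) (T : R -> E -> E)
    (tau s : R) (r : nat -> R) (e : nat -> E) (x : E) : C0_semigroup T ->
  0 <= s <= tau -> (forall n, 0 <= r n <= s) -> r @ \oo --> s -> e @ \oo --> x ->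
  T (tau - r n) (e n) @[n --> \oo] --> T (tau - s) x.
Proof.
move=> hT /andP[s0 st] r0s rs ex; have [M M0 hM] := C0_semigroup_bound tau hT.
have [Tb T0 TD Tc] := hT.
apply/cvgrPdist_le => eps eps0.
have e10 : 0 < eps / 2 / (M + 1) by rewrite !divr_gt0// ltr_wpDl.
have Me : M * (eps / 2 / (M + 1)) <= eps / 2.
  by rewrite mulrCA ger_pMr ?divr_gt0// ler_pdivrMr ?ltr_wpDl// mul1r lerDl.
have /cvgrPdist_le/(_ _ e10)/at_rightP[d d0 hd] := Tc x.
move/cvgrPdist_lt : rs => /(_ _ d0) rs; move/cvgrPdist_le : ex => /(_ _ e10) ex.
near=> n.
have /andP[rn0 rns] := r0s n.
have srn : s - r n < d.
  by apply: le_lt_trans (ler_norm _) _; near: n.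
have -> : tau - r n = (tau - s) + (s - r n) by rewrite addrA subrK.
set z := tau - s + (s - r n).
rewrite -(subrK (T z x) (T (tau - s) x)) -addrA /z.
rewrite (splitr eps) (le_trans (ler_normD _ _))// lerD//.
  rewrite (TD (tau - s) (s - r n)) ?subr_ge0//.
  rewrite -(linear_propB (Tb _ _).1) ?subr_ge0//.
  apply: le_trans (hM _ _ _) _; first by rewrite subr_ge0 st gerBl.
  apply: le_trans Me; rewrite ler_wpM2l//.
  (* The right neighbourhood of 0 excludes 0, so the case r n = s is separate. *)
  have : 0 <= s - r n by rewrite subr_ge0.
  rewrite le_eqVlt => /predU1P[<-|h].
    by rewrite T0 subrr normr0 ltW.
  by rewrite hd// h.
rewrite -(linear_propB (Tb _ _).1); last by rewrite addrA subrK subr_ge0 (le_trans rns).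
apply: le_trans (hM _ _ _) _.
  by rewrite addrA subrK subr_ge0 (le_trans rns)//= gerBl.
apply: le_trans Me; rewrite ler_wpM2l//; near: n; exact: ex.
Unshelve. all: by end_near. Qed.

End SemigroupBound.

Section InputMap.
Context {R : realType} {U Y : completeNormedModType R}.
Variables (S : R -> Y -> Y) (B : U -> Y).
Hypotheses (hS : C0_semigroup S) (hB : bounded_operator B).
Notation mu := (@lebesgue_measure R).

Let mI (t : R) : measurable `[0, t]%classic. Proof. exact: measurable_itv. Qed.

Lemma integral_norm_continuous_lty (E : normedModType R) (t : R) (u : R -> E) :
  continuous u -> (\int[mu]_(s in `[0%R, t]) (`|u s|)%:E < +oo)%E.
Proof.
move=> cu; have cn : continuous (fun s => `|u s| : R).
  by move=> s; apply: cvg_norm; exact: cu.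
have /integrableP[_] := @continuous_compact_integrable R (fun s => `|u s|)
   `[0, t]%classic (@segment_compact R 0 t) (continuous_subspaceT cn).
by under eq_integral do rewrite /= normr_id.
Qed.

Lemma strongly_measurable_input (tau : R) (u : R -> U) :
  strongly_measurable `[0, tau] u ->
  strongly_measurable `[0, tau] (fun s => S (tau - s) (B (u s))).
Proof.
move=> su; have [Sb S0 SD Sc] := hS; have [lB cB] := hB.
apply: (@strongly_measurable_parametric _ _ _ _ _ (fun r e => S (tau - r) (B e))) => //.
  move=> r /andP[r0 rt] a x y; rewrite lB.
  by apply: (Sb _ _).1; rewrite subr_ge0.
move=> s r e st r0 rs es.
apply: (@C0_semigroup_left_cvg _ _ S tau s r (B \o e)) => //.
exact: (cvg_comp _ _ es (cB _)).
Qed.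

(** The constant is uniform over all [t] up to [tau]. *)
Lemma integral_input_le (tau : R) : exists2 M, 0 <= M & forall t (u : R -> U),
  t <= tau -> strongly_measurable `[0, t] u ->
  (\int[mu]_(s in `[0%R, t]) (`|S (t - s) (B (u s))|)%:E <=
    M%:E * \int[mu]_(s in `[0%R, t]) (`|u s|)%:E)%E.
Proof.
have [M M0 hM] := C0_semigroup_bound tau hS; have [b b0 hb] := bounded_operator_le hB.
exists (M * b) => [|t u tt su]; first by rewrite mulr_ge0.
rewrite -integral_EFinZ ?mulr_ge0//; last exact: measurable_norm_strongly.
apply: le_integral_EFin => //.
- exact: (measurable_norm_strongly (mI t) (strongly_measurable_input su)).
- by apply: measurable_funM => //; exact: measurable_norm_strongly.
- move=> s /=; rewrite in_itv /= => /andP[s0 st].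
  apply: le_trans (hM _ _ _) _.
    by rewrite subr_ge0 st/= (le_trans _ tt)// gerBl.
  by rewrite -mulrA ler_wpM2l.
Qed.

(** For L^1 inputs [Phi] is a genuine integral and not the default value of the choice operator. *)
Lemma Phi_is_bochner_integral (tau : R) (u : R -> U) :
  strongly_measurable `[0, tau] u ->
  (\int[mu]_(s in `[0%R, tau]) (`|u s|)%:E < +oo)%E ->
  is_bochner_integral `[0, tau] (fun s => S (tau - s) (B (u s))) (Phi S B tau u).
Proof.
move=> su u1; have fI := lebesgue_measure_itv_cc_lty 0 tau.
have [M M0 hM] := integral_input_le tau.
have [|v hv] := is_bochner_integral_exists (mI tau) fI (strongly_measurable_input su).
  apply: le_lt_trans (hM _ _ (lexx _) su) _.
  by rewrite lte_mul_pinfty// lee_fin.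
by rewrite /Phi (bochner_integralE (mI tau) fI hv).
Qed.

Lemma PhiB (tau : R) (u v : R -> U) :
  strongly_measurable `[0, tau] u -> strongly_measurable `[0, tau] v ->
  (\int[mu]_(s in `[0%R, tau]) (`|u s|)%:E < +oo)%E ->
  (\int[mu]_(s in `[0%R, tau]) (`|v s|)%:E < +oo)%E ->
  Phi S B tau (fun s => u s - v s) = Phi S B tau u - Phi S B tau v.
Proof.
move=> su sv u1 v1; apply: bochner_integralE => //.
  exact: lebesgue_measure_itv_cc_lty.
have := is_bochner_integralB (mI tau) (Phi_is_bochner_integral su u1)
  (Phi_is_bochner_integral sv v1).
apply: is_bochner_integral_eq => // s; rewrite inE /= in_itv /= => /andP[s0 st].
have [Sb _ _ _] := hS; have [lB _] := hB.
by rewrite (linear_propB lB) (linear_propB (Sb _ _).1)// subr_ge0.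
Qed.

Lemma Phi_norm_le (tau : R) : exists2 M, 0 <= M & forall t (u : R -> U),
  t <= tau -> strongly_measurable `[0, t] u ->
  (\int[mu]_(s in `[0%R, t]) (`|u s|)%:E < +oo)%E ->
  (`|Phi S B t u|%:E <= M%:E * \int[mu]_(s in `[0%R, t]) (`|u s|)%:E)%E.
Proof.
have [M M0 hM] := integral_input_le tau; exists M => // t u tt su u1.
apply: le_trans (hM t u tt su); apply: bochner_integral_norm_le => //.
  exact: lebesgue_measure_itv_cc_lty.
exact: Phi_is_bochner_integral.
Qed.

(** Concatenation with [L = S h]: for s <= t the kernel S (t + h - s) factors as S h composed with S
    (t - s). *)
Lemma Phi_cocycle (t h : R) (u : R -> U) : 0 <= t -> 0 <= h -> continuous u ->
  Phi S B (t + h) u = S h (Phi S B t u) + Phi S B h (fun s => u (t + s)).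
Proof.
move=> t0 h0 cu; have [Sb S0 SD Sc] := hS.
have [M M0 hM] := bounded_operator_le (Sb _ h0).
have cv : continuous (fun s => u (t + s)).
  move=> s; apply: (@continuous_comp _ _ _ (fun s => t + s) u); last exact: cu.
  by apply: cvgD; [exact: cvg_cst|exact: cvg_id].
have smc w d : continuous w -> strongly_measurable `[0, d] (w : R -> U).
  exact: strongly_measurable_continuous.
apply: bochner_integralE => //; first exact: lebesgue_measure_itv_cc_lty.
apply: (is_bochner_integral_concat t0 h0 M0 (Sb _ h0).1 hM
  (Phi_is_bochner_integral (smc _ t cu) (integral_norm_continuous_lty t cu))
  (Phi_is_bochner_integral (smc _ h cv) (integral_norm_continuous_lty h cv))).
- exact/strongly_measurable_input/smc.
- by move=> s /andP[s0 st]; rewrite addrAC addrC SD ?subr_ge0.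
- by move=> s _; rewrite opprB addrCA addrA subrKC.
Qed.

End InputMap.

(** * Comparison for Dini derivatives *)

Section DiniComparison.
Context {R : realType}.
Notation mu := (@lebesgue_measure R).

(** Adding a slope [e1 > 0] leaves room: the set of times satisfying [z s <= z 0 + e1 * s] contains
    its supremum by continuity, and the right-hand hypothesis moves past any supremum smaller than
    [t]. *)
Lemma le0_of_dini_le (z : R -> R) (t : R) : continuous z -> 0 <= t ->
  (forall s e, 0 <= s -> 0 < e -> exists2 d, 0 < d &
     forall h, 0 < h < d -> z (s + h) - z s <= e * h) ->
  z t <= z 0.
Proof.
move=> cz t0 hz; apply/ler_addgt0Pr => e e0.
have e10 : 0 < e / (t + 1) by rewrite divr_gt0// ltr_wpDl.
pose e1 := e / (t + 1).
suff : z t <= z 0 + e1 * t.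
  move=> h; apply: (le_trans h); rewrite lerD2l /e1 -mulrA ger_pMr//.
  by rewrite mulrC ler_pdivrMr ?ltr_wpDl// mul1r lerDl.
pose A := [set s | 0 <= s <= t /\ z s <= z 0 + e1 * s].
have A0 : A 0 by split; rewrite ?lexx ?t0// mulr0 addr0.
have supA : has_sup A by split; [exists 0|exists t => s [/andP[]]].
pose c := sup A.
have c0 : 0 <= c by apply: ub_le_sup => //; exact: supA.2.
have ct : c <= t by apply: ge_sup => //; [exists 0|move=> s [/andP[]]].
have Ac : A c.
  split; first by rewrite c0.
  rewrite leNgt; apply/negP => zc.
  pose g s := z s - e1 * s.
  have cg : continuous g.
    by move=> s; apply: cvgB; [exact: cz|apply: cvgM; [exact: cvg_cst|exact: cvg_id]].
  have gc : 0 < g c - z 0 by rewrite /g subr_gt0 ltrBrDr.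
  have /cvgrPdist_lt/(_ _ gc)/nbhs_ballP[d /= d0 hd] := cg c.
  have [s As cs] := sup_adherent d0 supA.
  have sc : s <= c by apply: ub_le_sup => //; exact: supA.2.
  have /hd : ball c d s.
    by rewrite -ball_normE /= ger0_norm ?subr_ge0// ltrBlDl -ltrBlDr.
  move=> /(le_lt_trans (ler_norm _)); case: As => _; rewrite /g; lra.
have [cet|cnt] := eqVneq c t; first by rewrite -cet; case: Ac.
have {}ct : c < t by rewrite lt_neqAle cnt.
have [d d0 hd] := hz c e1 c0 e10.
pose h := Num.min (d / 2) (t - c).
have h0 : 0 < h by rewrite lt_min divr_gt0//= subr_gt0.
have hdd : h < d by rewrite gt_min; apply/orP; left; lra.
have hh : 0 < h < d by rewrite h0.
have ht : h <= t - c by rewrite ge_min lexx orbT.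
have : A (c + h).
  split; first by apply/andP; split; lra.
  by have := hd h hh; case: Ac => _; rewrite mulrDr; lra.
have supA2 := supA.2; move=> /(ub_le_sup supA2).
by rewrite -/c gerDl leNgt h0.
Qed.

Lemma continuous_antiderivative (f : R -> R) : continuous f ->
  exists F : R -> R, (forall x, -1 < x -> derivable F x 1 /\ derive1 F x = f x) /\
  forall t, 0 <= t ->
    (\int[mu]_(x in `[0%R, t]) (f x)%:E = (F t - F 0)%:E)%E.
Proof.
(* Starting the integral at -1 makes [F] differentiable from both sides at 0. *)
move=> cf; pose F x := (\int[mu]_(y in `[-1, x]) (f y))%R.
have dF x : -1 < x -> derivable F x 1 /\ derive1 F x = f x.
  move=> x1; apply: (@continuous_FTC1_closed _ f (-1) x (x + 1)) => //.
  - by rewrite ltrDl.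
  - apply: continuous_compact_integrable; first exact: segment_compact.
    exact: continuous_subspaceT.
  - exact: cf.
have cF x : -1 < x -> {for x, continuous F}.
  by move=> /dF[+ _] => /derivable1_diffP/differentiable_continuous.
exists F; split=> // t; rewrite le_eqVlt => /predU1P[<-|t0].
  by rewrite set_itv1 integral_set1 subrr.
rewrite EFinB; apply: continuous_FTC2 => //.
- exact: continuous_subspaceT.
- split.
  + by move=> x; rewrite in_itv /= => /andP[x0 _]; apply: (dF _ _).1; rewrite (lt_trans _ x0)// ltrN10.
  + by apply: cvg_at_right_filter; apply: cF; rewrite ltrN10.
  + by apply: cvg_at_left_filter; apply: cF; rewrite (lt_trans _ t0)// ltrN10.
- by move=> x; rewrite in_itv /= => /andP[x0 _]; apply: (dF _ _).2; rewrite (lt_trans _ x0)// ltrN10.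
Qed.

Lemma derivable_right_bound (F : R -> R) (x e : R) : derivable F x 1 -> 0 < e ->
  exists2 d, 0 < d & forall h, 0 < h < d ->
    `|F (x + h) - F x - h * derive1 F x| <= e * h.
Proof.
move=> dF e0.
have : h^-1 *: (F (h *: 1 + x) - F x) @[h --> 0^'] --> 'D_1 F x := dF.
move=> /cvgrPdist_le/(_ e e0)[d /= d0 hd]; exists d => // h /andP[h0 hh].
have := hd h; rewrite /= sub0r normrN gtr0_norm// => /(_ hh).
rewrite gt_eqF// => /(_ isT).
rewrite -derive1E /= [_ *: 1]mulr1 [h + x]addrC distrC => hF.
rewrite (_ : _ - _ = h * (h^-1 *: (F (x + h) - F x) - derive1 F x)).
  by rewrite normrM gtr0_norm// mulrC ler_wpM2r// ltW.
by rewrite mulrBr [h * (_ *: _)]mulrA divff ?mul1r// gt_eqF.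
Qed.

Lemma integral_le_of_dini (v f g : R -> R) (t : R) : continuous v -> continuous f ->
  continuous g -> 0 <= t ->
  (forall s e, 0 <= s -> 0 < e -> exists2 d, 0 < d &
     forall h, 0 < h < d -> v (s + h) - v s <= h * (g s - f s + e)) ->
  ((v t)%:E + \int[mu]_(x in `[0%R, t]) (f x)%:E <=
   (v 0)%:E + \int[mu]_(x in `[0%R, t]) (g x)%:E)%E.
Proof.
move=> cv cf cg t0 hv.
have [F [dF iF]] := continuous_antiderivative cf.
have [G [dG iG]] := continuous_antiderivative cg.
rewrite iF// iG// -!EFinD lee_fin.
(* [F] and [G] are controlled only to the right of -1; composing with the clamp [p] gives continuity
   on the whole line and changes nothing at times s >= 0. *)
pose p (s : R) : R := Num.max s 0.
have cp : continuous p.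
  move=> s; apply: (@continuous_max _ _ id (cst 0)); [exact: cvg_id|exact: cst_continuous].
have p1 s : -1 < p s by rewrite /p lt_max ltrN10 orbT.
have pE s : 0 <= s -> p s = s by move=> s0; rewrite /p max_l.
have cont (H : R -> R) : (forall x : R, -1 < x -> derivable H x 1) -> continuous (fun s => H (p s) : R).
  move=> dH s; apply: (@continuous_comp _ _ _ p H); first exact: cp.
  exact/differentiable_continuous/derivable1_diffP/dH.
pose z s := v s + F (p s) - G (p s).
suff : z t <= z 0 by rewrite /z !pE//; lra.
apply: le0_of_dini_le => //.
  move=> s; apply: cvgB; first apply: cvgD; first exact: cv.
    by apply: (cont F) => x /dF[].
  by apply: (cont G) => x /dG[].
move=> s e s0 e0; have e10 : 0 < e / 3 by rewrite divr_gt0.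
have s1 : -1 < s by rewrite (lt_le_trans _ s0)// ltrN10.
have [d1 d10 h1] := hv s _ s0 e10.
have [d2 d20 h2] := derivable_right_bound (dF _ s1).1 e10.
have [d3 d30 h3] := derivable_right_bound (dG _ s1).1 e10.
exists (Num.min d1 (Num.min d2 d3)); first by rewrite !lt_min d10 d20.
move=> h /andP[h0]; rewrite !lt_min => /and3P[hd1 hd2 hd3].
have := h1 h; rewrite h0 hd1 => /(_ isT) {}h1.
have := h2 h; rewrite h0 hd2 (dF _ s1).2 => /(_ isT); rewrite ler_norml => /andP[_ {}h2].
have := h3 h; rewrite h0 hd3 (dG _ s1).2 => /(_ isT); rewrite ler_norml => /andP[{}h3 _].
rewrite /z !pE ?addr_ge0// ?(ltW h0)//; nra.
Qed.

End DiniComparison.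

(** * Convergence in L^q *)

Section RieszFischer.
Context {R : realType} {E : completeNormedModType R}.
Notation mu := (@lebesgue_measure R).

Lemma cvg_of_geometric_steps (C : R) (a : nat -> E) :
  (forall n, `|a n.+1 - a n| <= C / 2 ^+ n) -> cvgn a.
Proof.
move=> ha.
have C0 : 0 <= C by have := ha 0%N; rewrite expr0 divr1; exact: le_trans.
(* The right-hand side is the exact value of the geometric sum of the steps from n to n + k - 1. *)
have step n k : `|a (n + k)%N - a n| <= 2 * C * (2^-1 ^+ n - 2^-1 ^+ (n + k)).
  elim: k => [|k IH]; first by rewrite addn0 !subrr normr0 mulr0.
  rewrite addnS -(subrK (a (n + k)%N) (a (n + k).+1)) -addrA.
  apply: le_trans (ler_normD _ _) _.
  have := ha (n + k)%N; rewrite -exprVn => h.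
  apply: le_trans (lerD h IH) _; rewrite exprS.
  by move: (2^-1 ^+ (n + k)) (2^-1 ^+ n) => y z; lra.
have small : (2 * C * 2^-1 ^+ n) @[n --> \oo] --> 0.
  rewrite -[X in _ --> X](mulr0 (2 * C)); apply: cvgM; first exact: cvg_cst.
  by apply: cvg_expr; rewrite ger0_norm ?invr_ge0// invf_lt1// ltr1n.
apply/cauchy_cvgP/cauchyP => e e0.
have /cvgrPdist_lt/(_ _ e0)[N _ hN] := small.
exists (a N), N => // n /= Nn; rewrite -ball_normE /= distrC.
rewrite -(subnKC Nn); apply: le_lt_trans (step _ _) _.
have := hN N (leqnn N); rewrite sub0r normrN.
move=> /(le_lt_trans (ler_norm _)); apply: le_lt_trans.
by rewrite ler_wpM2l ?mulr_ge0// gerBl exprn_ge0// invr_ge0.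
Qed.

(** The weight [(2^q)^n] equals [(2^n)^q], so a q-th root turns a bound on one term of the weighted
    series into geometric decay. *)
Lemma powR_weighted_le (q b S : R) (n : nat) : 0 < q -> 0 <= b ->
  (2 `^ q) ^+ n * b `^ q <= S -> b <= S `^ q^-1 / 2 ^+ n.
Proof.
move=> q0 b0; rewrite ler_pdivlMr ?exprn_gt0//.
rewrite -powR_mulrn ?powR_ge0// powRAC powR_mulrn//.
rewrite -powRM ?exprn_ge0// => h.
have S0 : 0 <= S by apply: le_trans h; exact: powR_ge0.
rewrite mulrC -[leLHS]powRr1 ?mulr_ge0 ?exprn_ge0//.
rewrite -[X in _ `^ X](@mulfV _ q) ?gt_eqF// powRrM.
by apply: ge0_ler_powR; rewrite ?nnegrE ?powR_ge0 ?invr_ge0// ltW.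
Qed.

(** The Riesz-Fischer argument for vector-valued functions, in a form that keeps pointwise
    convergence on an explicit set [N] of full measure. Setting [g] to 0 off [N] makes it an
    everywhere limit of simple functions restricted to [N]. *)
Lemma fast_Lp_cauchy_cvg (t q C : R) (phi : nat -> R -> E) : 1 <= q -> 0 <= C ->
  (forall n, strongly_measurable `[0, t] (phi n)) ->
  (forall n, (\int[mu]_(s in `[0%R, t]) (`|phi n s| `^ q)%:E < +oo)%E) ->
  (forall n, (\int[mu]_(s in `[0%R, t]) (`|phi n.+1 s - phi n s| `^ q)%:E <=
     (C * ((2 * 2 `^ q)^-1) ^+ n)%:E)%E) ->
  exists (N : set R) (g : R -> E), [/\ measurable N /\ N `<=` `[0, t],
    mu (`[0, t] `\` N) = 0%E, strongly_measurable `[0, t] g,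
    forall s, N s -> phi n s @[n --> \oo] --> g s &
    forall s, ~ N s -> g s = 0].
Proof.
move=> q1 C0 sphi iphi dphi.
have q0 : 0 < q by lra.
have mI : measurable `[0, t]%classic by exact: measurable_itv.
have r0 n : 0 < ((2 * 2 `^ q)^-1 : R) ^+ n.
  by rewrite exprn_gt0// invr_gt0 mulr_gt0// powR_gt0.
have /choice[z hz] : forall n, exists z : seq (set R * E), is_simple z /\
    (\int[mu]_(s in `[0%R, t]) (`|phi n s - simple_eval z s| `^ q)%:E <=
      (((2 * 2 `^ q)^-1) ^+ n)%:E)%E.
  move=> n; have [z [hz zc zd]] := strongly_measurable_dominated mI (sphi n).
  have i0 k : (0 <= \int[mu]_(s in `[0%R, t]) (`|phi n s - simple_eval (z k) s| `^ q)%:E)%E.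
    by apply: integral_EFin_ge0 => s _; exact: powR_ge0.
  have [k _ hk] := (cvge0_leP i0).1 (dominated_powR_cvg mI q0 (sphi n) (iphi n) hz zc zd) _ (r0 n).
  by exists (z k); split=> //; exact: (hk k (leqnn k)).
have hzs n := (hz n).1; have hzi n := (hz n).2.
pose w n : R := (2 `^ q) ^+ n.
have w0 n : 0 < w n by rewrite exprn_gt0// powR_gt0.
(* Where the sum of the [h n] is finite, both [phi n.+1 - phi n] and
   [phi n - simple_eval (z n)] are O(2^-n); so the simple functions [z n] have the
   same limit as [phi n], which makes this limit strongly measurable. *)
pose h n s : R := w n * (`|phi n.+1 s - phi n s| `^ q + `|phi n s - simple_eval (z n) s| `^ q).
have h0 n s : 0 <= h n s by rewrite mulr_ge0 ?(ltW (w0 n))// addr_ge0 ?powR_ge0.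
have mpow (g : R -> E) : strongly_measurable `[0, t] g ->
    measurable_fun `[0, t] (fun x => `|g x| `^ q).
  move=> sg; apply: (measurableT_comp (measurable_powR _)).
  exact: measurable_norm_strongly.
have sz n := strongly_measurable_simple `[0, t] (hzs n).
have m1 n := mpow _ (strongly_measurableB (sphi n.+1) (sphi n)).
have m2 n := mpow _ (strongly_measurableB (sphi n) (sz n)).
have mh n : measurable_fun `[0, t] (h n).
  by apply: measurable_funM => //; exact: measurable_funD.
(* The bound is [(C + 1) / 2^n], written in the shape of the halving geometric series. *)
have ih n : (\int[mu]_(s in `[0%R, t]) (h n s)%:E <= (2 * (C + 1) / (2 ^ (n + 1))%:R)%:E)%E.
  rewrite integral_EFinZ ?(ltW (w0 n))//; last exact: measurable_funD.
  rewrite integral_EFinD//.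
  apply: (@le_trans _ _ ((w n)%:E * ((C * ((2 * 2 `^ q)^-1) ^+ n)%:E + (((2 * 2 `^ q)^-1) ^+ n)%:E))%E).
    by rewrite lee_wpmul2l ?lee_fin ?(ltW (w0 n))// leeD.
  rewrite -EFinD -EFinM lee_fin addn1 natrX exprS /w invfM exprMn.
  have : (2 `^ q) ^+ n * ((2 `^ q)^-1) ^+ n = 1 :> R.
    by rewrite -exprMn mulfV ?expr1n// gt_eqF// powR_gt0.
  rewrite invfM [2^-1 ^+ n]exprVn.
  move: ((2 `^ q) ^+ n) ((2 `^ q)^-1 ^+ n) ((2 ^+ n)^-1) => a b c ab.
  rewrite (_ : a * _ = (a * b) * ((C + 1) * c)); last by ring.
  rewrite ab (_ : 2 * (C + 1) * (2^-1 * c) = (2 * 2^-1) * ((C + 1) * c)); last by ring.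
  by rewrite mulfV.
pose H s : \bar R := (\sum_(0 <= n <oo | n \in predT) (h n s)%:E)%E.
have mH : measurable_fun `[0, t] H.
  by apply: ge0_emeasurable_sum => [k s _ _|k _]; [rewrite lee_fin|apply/measurable_EFinP; exact: mh].
have H0 s : (0 <= H s)%E by apply: nneseries_ge0 => n _ _; rewrite lee_fin.
have iH : (\int[mu]_(s in `[0%R, t]) H s < +oo)%E.
  rewrite integral_nneseries//; [|move=> n; apply/measurable_EFinP; exact: mh|by move=> n s _; rewrite lee_fin].
  apply: (@le_lt_trans _ _ (\sum_(0 <= n <oo) (2 * (C + 1) / (2 ^ (n + 1))%:R)%:E)%E).
    apply: lee_nneseries => [n _ _|n _]; last exact: ih.
    exact: integral_EFin_ge0.
  have -> : (\sum_(0 <= n <oo) (2 * (C + 1) / (2 ^ (n + 1))%:R)%:E)%E = (2 * (C + 1) / 2 ^+ 0)%:E.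
    by apply: cvg_lim => //; exact: (@cvg_geometric_eseries_half R (2 * (C + 1)) 0).
  exact: ltry.
have intH : mu.-integrable `[0, t] H.
  by apply/integrableP; split=> //; under eq_integral do rewrite gee0_abs//.
have [Z [mZ Z0 subZ]] := @integrable_ae _ _ _ mu _ mI _ intH.
pose N := `[0, t]%classic `\` Z.
have mN : measurable N by exact: measurableD.
have NI : N `<=` `[0, t] by move=> s [].
have HN s : N s -> H s \is a fin_num.
  by move=> [Is nZ]; apply: contrapT => Hs; apply: nZ; apply: subZ => /(_ Is).
have hH n s : N s -> h n s <= fine (H s).
  move=> Ns; rewrite -lee_fin fineK ?HN//.
  have u0 k : (0 <= k)%N -> k \in predT -> (0 <= (h k s)%:E)%E by rewrite lee_fin.
  apply: le_trans (nneseries_lim_ge n.+1 u0).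
  by rewrite big_nat_recr//= leeDr// sume_ge0// => k _; rewrite lee_fin.
have step n s : N s -> `|phi n.+1 s - phi n s| <= fine (H s) `^ q^-1 / 2 ^+ n.
  move=> Ns; apply: powR_weighted_le => //; apply: le_trans (hH n s Ns).
  by rewrite ler_wpM2l ?(ltW (w0 n))// lerDl powR_ge0.
have stepz n s : N s -> `|phi n s - simple_eval (z n) s| <= fine (H s) `^ q^-1 / 2 ^+ n.
  move=> Ns; apply: powR_weighted_le => //; apply: le_trans (hH n s Ns).
  by rewrite ler_wpM2l ?(ltW (w0 n))// lerDr powR_ge0.
pose g s := if s \in N then limn (phi^~ s) else 0.
have gN s : N s -> phi n s @[n --> \oo] --> g s.
  move=> Ns; rewrite /g mem_set//.
  by apply: cvg_of_geometric_steps => n; exact: step.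
have gN' s : ~ N s -> g s = 0 by move=> Ns; rewrite /g memNset.
exists N, g; split=> //.
- apply/eqP; rewrite -measure_le0 -Z0; apply: le_measure; rewrite ?inE//.
    exact: measurableD.
  by move=> s [Is]; apply: contra_notP => nZ; split.
- exists (fun n => simple_restrict N (z n)); split=> [n|s Is].
    exact: is_simple_restrict.
  under eq_fun do rewrite simple_eval_restrict indicE.
  have [Ns|Ns] := pselect (N s); last first.
    rewrite gN'// memNset//; under eq_fun do rewrite scale0r; exact: cvg_cst.
  rewrite mem_set//; under eq_fun do rewrite scale1r.
  rewrite (_ : (fun _ => _) = (fun n => phi n s - (phi n s - simple_eval (z n) s))); last first.
    by apply/funext => n; rewrite subKr.
  rewrite -[g s]subr0; apply: cvgB; first exact: gN.
  apply/norm_cvg0P; apply: (@squeeze_cvgr _ _ _ _ (cst 0) (fun n => fine (H s) `^ q^-1 * 2^-1 ^+ n)).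
  - by apply: nearW => n; rewrite normr_ge0/= exprVn stepz.
  - exact: cvg_cst.
  - rewrite -[X in _ --> X](mulr0 (fine (H s) `^ q^-1)); apply: cvgM; first exact: cvg_cst.
    by apply: cvg_expr; rewrite ger0_norm ?invr_ge0// invf_lt1// ltr1n.
Qed.

(** Multiplying by the indicator of [N] makes the powers converge everywhere, since [g] vanishes off
    [N] and 0^q = 0; Fatou's lemma then applies directly. *)
Lemma fatou_Lp (t q : R) (b : nat -> \bar R) (l : \bar R) (N : set R)
    (phi : nat -> R -> E) (g : R -> E) : 0 < q ->
  measurable N -> (forall n, strongly_measurable `[0, t] (phi n)) ->
  (forall s, N s -> phi n s @[n --> \oo] --> g s) -> (forall s, ~ N s -> g s = 0) ->
  (forall n, (\int[mu]_(s in `[0%R, t]) (`|phi n s| `^ q)%:E <= b n)%E) ->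
  b @ \oo --> l ->
  (\int[mu]_(s in `[0%R, t]) (`|g s| `^ q)%:E <= l)%E.
Proof.
move=> q0 mN sphi gN gN' phib bl.
have mI : measurable `[0, t]%classic by exact: measurable_itv.
have mpow n : measurable_fun `[0, t] (fun x => `|phi n x| `^ q).
  by apply: (measurableT_comp (measurable_powR _)); exact: measurable_norm_strongly.
pose f n s : R := \1_N s * `|phi n s| `^ q.
have f0 n s : 0 <= f n s by rewrite mulr_ge0 ?powR_ge0.
have mf n : measurable_fun `[0, t] (f n).
  by apply: measurable_funM => //; exact: mpow.
have mfE n : measurable_fun `[0, t] (EFin \o f n) by apply/measurable_EFinP; exact: mf.
have -> : (\int[mu]_(s in `[0%R, t]) (`|g s| `^ q)%:E =
    \int[mu]_(s in `[0%R, t]) limn_einf (fun n => (f n s)%:E))%E.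
  apply: eq_integral => s _; suff fg : (f n s)%:E @[n --> \oo] --> (`|g s| `^ q)%:E.
    by rewrite (cvg_limn_einf_sup fg).1.
  apply: cvg_EFin; first exact: nearW.
  rewrite /f indicE; have [Ns|Ns] := pselect (N s); last first.
    rewrite memNset// gN'// normr0 powR0 ?gt_eqF//.
    by under eq_fun do rewrite mul0r; exact: cvg_cst.
  rewrite mem_set//; under eq_fun do rewrite mul1r -(normr_id (phi _ s)).
  rewrite -(normr_id (g s)).
  exact: (cvg_comp _ _ (cvg_norm (gN s Ns)) (@continuous_norm_powR R q q0 `|g s|)).
have f0E n s : `[0, t]%classic s -> (0 <= (f n s)%:E)%E by rewrite lee_fin.
apply: (le_trans (@fatou _ _ _ mu _ mI (fun n s => (f n s)%:E) mfE f0E)).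
rewrite limn_einf_lim -(cvg_lim _ bl)//.
apply: lee_lim; [exact: is_cvg_einfs|by apply/cvg_ex; exists l|].
apply: nearW => n; apply: le_trans (phib n).
apply: (@le_trans _ _ (\int[mu]_(s in `[0%R, t]) (f n s)%:E)%E).
  by apply: ereal_inf_lbound; exists n => /=.
apply: le_integral_EFin => // s _.
by rewrite /f indicE; case: (s \in N); rewrite ?mul1r ?mul0r// powR_ge0.
Qed.

End RieszFischer.

(** * Lyapunov estimate for continuous inputs *)

Section EnergyEstimate.
Context {R : realType} {X U Y : completeNormedModType R}.
Variables (j : X -> Y) (T : R -> X -> X) (S : R -> Y -> Y) (B : U -> Y).
Hypotheses (hT : C0_semigroup T) (hS : C0_semigroup S) (hB : bounded_operator B).
Hypothesis ij : injective j.
Hypothesis hTS : forall t x, 0 <= t -> S t (j x) = j (T t x).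
Notation mu := (@lebesgue_measure R).

(** Inputs and solutions matter only at nonnegative times. Extending by the value at 0 replaces
    continuity within the half-line by continuity on the line. *)
Lemma clamp_continuous (E : normedModType R) (f : R -> E) :
  {within `[0, +oo[, continuous f} -> continuous (fun s : R => f (Num.max s 0)).
Proof.
move=> /subspace_continuousP cf s.
have cp : continuous (fun s : R => Num.max s 0 : R).
  move=> r; apply: (@continuous_max _ _ id (cst 0)); [exact: cvg_id|exact: cst_continuous].
have p0 (r : R) : `[0, +oo[%classic (Num.max r 0).
  by rewrite /= in_itv /= andbT le_max lexx orbT.
apply: (cvg_comp _ _ _ (cf _ (p0 s))).
move=> A [d /= d0 hd].
have /cvgrPdist_lt/(_ d d0) := cp s.
by apply: filterS => r hr; exact: (hd _ hr (p0 r)).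
Qed.

Lemma toXE x : toX j (j x) = x.
Proof. by apply: xget_subset1 => // a b /= ja jb; apply: ij; rewrite ja jb. Qed.

Lemma Phi0 (u : R -> U) : continuous u -> Phi S B 0 u = 0.
Proof.
move=> cu; have [M M0 hM] := Phi_norm_le hS hB 0.
have := hM 0 u (lexx 0) (strongly_measurable_continuous 0 cu)
  (integral_norm_continuous_lty 0 cu).
by rewrite set_itv1 integral_set1 mule0 lee_fin normr_le0 => /eqP.
Qed.

Lemma mild_cocycle (s h : R) (x y : X) (u : R -> U) : 0 <= s -> 0 <= h ->
  continuous u -> j y = mild j T S B s x u ->
  mild j T S B (s + h) x u = mild j T S B h y (fun r => u (s + r)).
Proof.
move=> s0 h0 cu jy; rewrite /mild -[j (T h y)]hTS// jy /mild (Phi_cocycle hS hB)//.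
have [Sb _ _ _] := hS; have [_ _ TD _] := hT.
by rewrite (linear_propD (Sb _ h0).1) hTS// [s + h]addrC TD// addrA.
Qed.

Lemma lyapunov_energy_le (q : R) (V : X -> R) : 1 <= q ->
  noncoercive_ISS_Lyapunov j T S B q V ->
  exists2 K, 0 < K & forall (t : R) (x : X) (u : R -> U) (phi : R -> X),
    0 <= t -> continuous u -> continuous phi ->
    (forall s, 0 <= s -> j (phi s) = mild j T S B s x u) ->
    (\int[mu]_(s in `[0%R, t]) (`|phi s| `^ q)%:E <=
      K%:E * ((`|x| `^ q)%:E + \int[mu]_(s in `[0%R, t]) (`|u s| `^ q)%:E))%E.
Proof.
move=> q1 [cV V0 VZ [a2 [a3 [a4 [a20 a30 a40 Vle dV]]]]].
have q0 : 0 < q by lra.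
exists (a3^-1 * (a2 + a4)) => [|t x u phi t0 cu cphi phiE].
  by rewrite mulr_gt0 ?invr_gt0// addr_gt0.
have mI : measurable `[0, t]%classic by exact: measurable_itv.
(* The upper bound is assumed for nonzero states only; [V 0 = 0] comes from homogeneity with factor
   0. *)
have VX : V x <= a2 * `|x| `^ q.
  have [->|x0] := eqVneq x 0; last exact: (Vle x x0).2.
  by rewrite -(scale0r (0 : X)) VZ scale0r !normr0 powR0 ?gt_eqF// mul0r mulr0.
have cpow (E : normedModType R) (w : R -> E) : continuous w ->
    continuous (fun s => `|w s| `^ q).
  move=> cw s; have -> : (fun s => `|w s| `^ q) = (fun s => `| `|w s| | `^ q).
    by apply/funext => r; rewrite normr_id.
  apply: (@continuous_comp _ _ _ (fun s => `|w s| : R) (fun r => `|r| `^ q)).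
    by apply: cvg_norm; exact: cw.
  exact: continuous_norm_powR.
have mpow (E : normedModType R) (w : R -> E) : continuous w ->
    measurable_fun `[0, t] (fun s => `|w s| `^ q : R).
  by move=> /cpow cw; apply: measurable_funTS; exact: continuous_measurable_fun.
have phi0 : phi 0 = x.
  apply: ij; rewrite phiE// /mild Phi0// addr0.
  by have [_ -> _ _] := hT.
have cscale (k : R) (f : R -> R) : continuous f -> continuous (fun s => k * f s).
  by move=> cf s; apply: cvgM; [exact: cvg_cst|exact: cf].
have dini s e : 0 <= s -> 0 < e -> exists2 d, 0 < d & forall h, 0 < h < d ->
    (V \o phi) (s + h) - (V \o phi) s <= h * (a4 * `|u s| `^ q - a3 * `|phi s| `^ q + e).
  move=> s0 e0; pose us r := u (s + r).
  have cus : continuous us.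
    move=> r; apply: (@continuous_comp _ _ _ (fun r => s + r) u); last exact: cu.
    by apply: cvgD; [exact: cvg_cst|exact: cvg_id].
  have := dV (phi s) us (continuous_subspaceT cus).
  rewrite /us addr0 => hV.
  have {hV} : (lie_derivative j T S B V us (phi s) <
      (- a3 * `|phi s| `^ q + a4 * `|u s| `^ q + e)%:E)%E.
    by apply: le_lt_trans hV _; rewrite lte_fin ltrDl.
  (* The limsup is an infimum of suprema over right neighbourhoods of 0; one of these suprema is
     already below the strict bound, hence so are all its difference quotients. *)
  move=> /ereal_inf_lt[_ [A FA <-] supA].
  have [d d0 hd] := at_rightP FA.
  exists d => // h hh; have /andP[h0 _] := hh.
  have : ((h^-1 * (V (toX j (mild j T S B h (phi s) us)) - V (phi s)))%:E <
      (- a3 * `|phi s| `^ q + a4 * `|u s| `^ q + e)%:E)%E.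
    by apply: le_lt_trans supA; apply: ereal_sup_ubound; exists h => //; exact: hd.
  (* Restarting at [phi s] with the shifted input leads to [phi (s + h)], so the Lie derivative at
     [phi s] is the Dini derivative of [V \o phi] at [s]. *)
  rewrite -(mild_cocycle s0 (ltW h0) cu (phiE s s0)) -phiE; last by rewrite addr_ge0// ltW.
  rewrite toXE lte_fin ltr_pdivrMl// => /ltW /le_trans; apply.
  by rewrite ler_pM2l// mulNr lerD2r addrC.
have cVphi : continuous (V \o phi).
  by move=> s; apply: continuous_comp; [exact: cphi|exact: cV].
have := integral_le_of_dini cVphi (cscale a3 _ (cpow _ _ cphi))
  (cscale a4 _ (cpow _ _ cu)) t0 dini.
have ip (E : normedModType R) (w : R -> E) : (0 <= \int[mu]_(s in `[0%R, t]) (`|w s| `^ q)%:E)%E.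
  by apply: integral_EFin_ge0 => s _; exact: powR_ge0.
rewrite /= phi0 !integral_EFinZ ?(ltW a30) ?(ltW a40)//; try exact: mpow.
move: (ip _ phi) (ip _ u).
move: (\int[mu]_(s in `[0%R, t]) (`|phi s| `^ q)%:E)%E => P.
move: (\int[mu]_(s in `[0%R, t]) (`|u s| `^ q)%:E)%E => Q P0 Q0 h.
rewrite EFinM -muleA lee_pdivlMl// ge0_muleDr ?lee_fin ?powR_ge0//.
apply: (@le_trans _ _ ((V x)%:E + a4%:E * Q)%E).
  by apply: le_trans h; rewrite leeDr// lee_fin.
apply: leeD.
  by rewrite -EFinM lee_fin (le_trans VX)// ler_wpM2r ?powR_ge0// lerDl ltW.
by rewrite lee_wpmul2r// lee_fin lerDr ltW.
Qed.

End EnergyEstimate.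

(** * Inputs in L^q *)

Section MildSolutionLq.
Context {R : realType} {X U Y : completeNormedModType R}.
Variables (j : X -> Y) (T : R -> X -> X) (S : R -> Y -> Y) (B : U -> Y).
Hypotheses (hT : C0_semigroup T) (hS : C0_semigroup S) (hB : bounded_operator B).
Hypotheses (bj : bounded_operator j).
Hypothesis hcont : continuous_mild_solutions j T S B.
Notation mu := (@lebesgue_measure R).

Lemma integral_powR_norm_le (E F G : normedModType R) (q t : R) (a : R -> E) (b : R -> F)
    (c : R -> G) : 0 <= q -> strongly_measurable `[0, t] a ->
  strongly_measurable `[0, t] b -> strongly_measurable `[0, t] c ->
  (forall s, 0 <= s <= t -> `|c s| <= `|a s| + `|b s|) ->
  (\int[mu]_(s in `[0%R, t]) (`|c s| `^ q)%:E <=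
    (2 `^ q)%:E * (\int[mu]_(s in `[0%R, t]) (`|a s| `^ q)%:E +
                   \int[mu]_(s in `[0%R, t]) (`|b s| `^ q)%:E))%E.
Proof.
move=> q0 sa sb sc cab.
have mI : measurable `[0, t]%classic by exact: measurable_itv.
have mpow (H : normedModType R) (w : R -> H) : strongly_measurable `[0, t] w ->
    measurable_fun `[0, t] (fun s => `|w s| `^ q).
  move=> sw; apply: (measurableT_comp (measurable_powR _)).
  exact: measurable_norm_strongly.
have pab : measurable_fun `[0, t] (fun s => `|a s| `^ q + `|b s| `^ q).
  by apply: measurable_funD; exact: mpow.
rewrite -integral_EFinD//; try exact: mpow.
rewrite -integral_EFinZ ?powR_ge0//.
apply: le_integral_EFin => //; try exact: mpow.
  exact: measurable_funM.
move=> s /= Is; apply: le_trans (powR_normD_le _ _ _) => //.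
by apply: ge0_ler_powR; rewrite ?nnegrE ?addr_ge0// cab.
Qed.

Lemma continuous_mild_continuation (x : X) (w : R -> U) : continuous w ->
  exists phi : R -> X, continuous phi /\
    forall s, 0 <= s -> j (phi s) = mild j T S B s x w.
Proof.
move=> cw; have [phi cphi phiE] := hcont x (continuous_subspaceT cw).
exists (fun s => phi (Num.max s 0)); split; first exact: clamp_continuous.
by move=> s s0; rewrite max_l// phiE.
Qed.

(** The energy estimate is assumed for every initial state: for the given [x] it bounds the
    solutions, for 0 it bounds their differences. *)
Lemma mild_Lq_estimate (q K t : R) (x : X) (u : R -> U) : 1 <= q -> 0 < K -> 0 <= t ->
  (forall (x : X) (u : R -> U) (phi : R -> X), continuous u -> continuous phi ->
    (forall s, 0 <= s -> j (phi s) = mild j T S B s x u) ->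
    (\int[mu]_(s in `[0%R, t]) (`|phi s| `^ q)%:E <=
      K%:E * ((`|x| `^ q)%:E + \int[mu]_(s in `[0%R, t]) (`|u s| `^ q)%:E))%E) ->
  strongly_measurable `[0, t] u ->
  (\int[mu]_(s in `[0%R, t]) (`|u s| `^ q)%:E < +oo)%E ->
  exists g : R -> X, [/\ strongly_measurable `[0, t] g,
    (\int[mu]_(s in `[0%R, t]) (`|g s| `^ q)%:E <=
      K%:E * ((`|x| `^ q)%:E +
        (2 `^ q)%:E * \int[mu]_(s in `[0%R, t]) (`|u s| `^ q)%:E))%E &
    {ae mu, forall s : R, s \in `[0, t] -> j (g s) = mild j T S B s x u}].
Proof.
move=> q1 K0 t0 energy su iu.
have q0 : 0 < q by lra.
have mI : measurable `[0, t]%classic by exact: measurable_itv.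
have [lB cB] := hB; have [lj cj] := bj.
(* The rate required by [fast_Lp_cauchy_cvg]. *)
pose r : R := (2 * 2 `^ q)^-1.
have r0 : 0 < r by rewrite invr_gt0 mulr_gt0// powR_gt0.
have r1 : r < 1.
  rewrite invf_lt1 ?mulr_gt0 ?powR_gt0//.
  have p1 : 1 <= 2 `^ q :> R.
    by rewrite -[leLHS](powRr0 2); apply: ler_powR; rewrite ?ler1n// ltW.
  by rewrite (@lt_le_trans _ _ 2) ?ltr1n// ler_pMr.
have e0 n : 0 < r ^+ n by rewrite exprn_gt0.
have /choice[w hw] : forall n, exists w : R -> U, [/\ continuous w,
    (\int[mu]_(s in `[0%R, t]) (`|u s - w s| `^ q)%:E <= (r ^+ n)%:E)%E &
    (\int[mu]_(s in `[0%R, t]) (`|u s - w s|)%:E <= (r ^+ n)%:E)%E].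
  by move=> n; exact: continuous_dense_Lp.
have cw n : continuous (w n) by case: (hw n).
have sw n s := strongly_measurable_continuous s (cw n).
have suw n := strongly_measurableB su (sw n t).
have /choice[phi hphi] : forall n, exists phi : R -> X, continuous phi /\
    forall s, 0 <= s -> j (phi s) = mild j T S B s x (w n).
  by move=> n; exact: continuous_mild_continuation.
have cphi n := (hphi n).1; have phiE n := (hphi n).2.
have sphi n := strongly_measurable_continuous t (cphi n).
(* This is where the factor [2^q] of the conclusion arises; the error [r ^+ n] disappears in the
   limit. *)
have iw n : (\int[mu]_(s in `[0%R, t]) (`|w n s| `^ q)%:E <= (2 `^ q)%:E *
    (\int[mu]_(s in `[0%R, t]) (`|u s| `^ q)%:E + (r ^+ n)%:E))%E.
  have := integral_powR_norm_le (ltW q0) su (suw n) (sw n t) _.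
  move=> /(_ _)/le_trans; apply.
    by move=> s _; rewrite -{1}(subKr (u s) (w n s)) ler_normB.
  by rewrite lee_wpmul2l ?lee_fin ?powR_ge0// leeD2l//; case: (hw n).
have [i iE] : exists i : R, (\int[mu]_(s in `[0%R, t]) (`|u s| `^ q)%:E = i%:E)%E.
  exists (fine (\int[mu]_(s in `[0%R, t]) (`|u s| `^ q)%:E)); rewrite fineK//.
  by rewrite ge0_fin_numE// integral_EFin_ge0// => s _; exact: powR_ge0.
pose b n : R := K * (`|x| `^ q + 2 `^ q * (i + r ^+ n)).
have phib n : (\int[mu]_(s in `[0%R, t]) (`|phi n s| `^ q)%:E <= (b n)%:E)%E.
  apply: le_trans (energy x (w n) (phi n) (cw n) (cphi n) (phiE n)) _.
  rewrite /b EFinM EFinD lee_wpmul2l ?lee_fin ?(ltW K0)// leeD2l//.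
  by rewrite EFinM EFinD -iE.
(* The input difference costs 2^q (r^n + r^(n+1)), at most 2 2^q r^n because r < 1. *)
have dphi n : (\int[mu]_(s in `[0%R, t]) (`|phi n.+1 s - phi n s| `^ q)%:E <=
    (K * (2 * 2 `^ q) * r ^+ n)%:E)%E.
  pose dw s := w n.+1 s - w n s.
  have cdw : continuous dw by move=> s; apply: cvgB; exact: cw.
  have cdphi : continuous (fun s => phi n.+1 s - phi n s).
    by move=> s; apply: cvgB; exact: cphi.
  have dphiE s : 0 <= s -> j (phi n.+1 s - phi n s) = mild j T S B s 0 dw.
    move=> s0; rewrite (linear_propB lj) !phiE// /mild.
    have [Tb _ _ _] := hT; rewrite (linear_prop0 (Tb _ s0).1) (linear_prop0 lj) add0r.
    rewrite /dw (PhiB hS hB (sw n.+1 s) (sw n s));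
      try exact: integral_norm_continuous_lty.
    by rewrite opprD addrACA subrr add0r.
  apply: le_trans (energy 0 dw _ cdw cdphi dphiE) _.
  rewrite normr0 powR0 ?gt_eqF// add0e -mulrA EFinM lee_wpmul2l ?lee_fin ?(ltW K0)//.
  have := integral_powR_norm_le (ltW q0) (suw n) (suw n.+1)
    (strongly_measurable_continuous t cdw) _.
  move=> /(_ _)/le_trans; apply.
    move=> s _; rewrite [X in _ <= _ + X]distrC [X in _ <= X]addrC /dw.
    by rewrite -{1}(subrK (u s) (w n.+1 s)) -addrA ler_normD.
  rewrite -mulrA mulrCA EFinM lee_wpmul2l ?lee_fin ?powR_ge0//.
  apply: (@le_trans _ _ ((r ^+ n)%:E + (r ^+ n.+1)%:E)%E).
    by apply: leeD; [case: (hw n)|case: (hw n.+1)].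
  by rewrite -EFinD lee_fin mulr2n mulrDl mul1r lerD2l exprS ler_piMl ?(ltW r1)// ltW.
have C0 : 0 <= K * (2 * 2 `^ q) by rewrite !mulr_ge0 ?powR_ge0// ltW.
have iphi n : (\int[mu]_(s in `[0%R, t]) (`|phi n s| `^ q)%:E < +oo)%E.
  exact: le_lt_trans (phib n) (ltry _).
have [N [g [[mN NI] N0 sg gN gN']]] := fast_Lp_cauchy_cvg q1 C0 sphi iphi dphi.
have rcvg : r ^+ n @[n --> \oo] --> 0 by apply: cvg_expr; rewrite ger0_norm// ltW.
exists g; split=> //.
  apply: (fatou_Lp q0 mN sphi gN gN' phib).
  have -> : (K%:E * ((`|x| `^ q)%:E + (2 `^ q)%:E *
      \int[mu]_(s in `[0%R, t]) (`|u s| `^ q)%:E))%E =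
      (K * (`|x| `^ q + 2 `^ q * (i + 0)))%:E.
    by rewrite iE addr0 EFinM EFinD EFinM.
  apply: cvg_EFin; first exact: nearW.
  apply: cvgM; first exact: cvg_cst.
  apply: cvgD; first exact: cvg_cst.
  apply: cvgM; first exact: cvg_cst.
  by apply: cvgD; [exact: cvg_cst|exact: rcvg].
exists (`[0, t] `\` N); split=> //; first exact: measurableD.
move=> s /= /not_implyP[Is jgs]; split=> // Ns; apply: jgs.
have /andP[s0 st] : 0 <= s <= t by move: Is; rewrite in_itv.
have jphi : j (phi n s) @[n --> \oo] --> j (g s).
  exact: (cvg_comp _ _ (gN s Ns) (cj (g s))).
apply: (cvg_unique _ jphi) => //.
rewrite (_ : (fun n => j (phi n s)) = (fun n => mild j T S B s x (w n))); last first.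
  by apply/funext => n; rewrite phiE.
rewrite /mild; apply: cvgD; first exact: cvg_cst.
have sub_st : `[0, s]%classic `<=` `[0, t]%classic by apply: subset_itvl; rewrite bnd_simp.
have su' : strongly_measurable `[0, s] u by exact: strongly_measurable_eq su.
have suw' n := strongly_measurableB su' (sw n s).
have i1 n : (\int[mu]_(y in `[0%R, s]) (`|u y - w n y|)%:E <= (r ^+ n)%:E)%E.
  case: (hw n) => _ _; apply: le_trans; apply: ge0_subset_integral => //.
  by apply/measurable_EFinP; exact: measurable_norm_strongly.
have iu1 : (\int[mu]_(y in `[0%R, s]) (`|u y|)%:E < +oo)%E.
  have mIs : measurable `[0, s]%classic by exact: measurable_itv.
  apply: (@le_lt_trans _ _ (\int[mu]_(y in `[0%R, s]) (`|u y - w 0%N y| + `|w 0%N y|)%:E)%E).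
    apply: le_integral_EFin => //.
    - exact: measurable_norm_strongly.
    - by apply: measurable_funD; exact: measurable_norm_strongly.
    - by move=> y _; rewrite -{1}(subrK (w 0%N y) (u y)) ler_normD.
  rewrite integral_EFinD//; try exact: measurable_norm_strongly.
  rewrite lte_add_pinfty//; first exact: le_lt_trans (i1 0%N) (ltry _).
  exact: integral_norm_continuous_lty.
have [M M0 hM] := Phi_norm_le hS hB s.
have wcont n := integral_norm_continuous_lty s (cw n).
have i1y n : (\int[mu]_(y in `[0%R, s]) (`|u y - w n y|)%:E < +oo)%E.
  exact: le_lt_trans (i1 n) (ltry _).
have Phile n : `|Phi S B s u - Phi S B s (w n)| <= M * r ^+ n.
  rewrite -(PhiB hS hB su' (sw n s) iu1 (wcont n)) -lee_fin.
  apply: le_trans (hM s _ (lexx s) (suw' n) (i1y n)) _.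
  by rewrite EFinM lee_wpmul2l ?lee_fin.
apply/cvgrPdist_le => e ee0.
have Mr : M * r ^+ n @[n --> \oo] --> 0.
  rewrite -(mulr0 M); apply: cvgM; [exact: cvg_cst|exact: rcvg].
have /cvgr0Pnorm_le/(_ e ee0) := Mr.
by apply: filterS => n; apply: le_trans; apply: le_trans (Phile n) (ler_norm _).
Qed.

End MildSolutionLq.

(** * Power integrals and L^q norms *)

Section LqNorm.
Context {R : realType} {E : normedModType R}.
Notation mu := (@lebesgue_measure R).

Lemma Lq_normE (q t : R) (f : R -> E) : 0 < q ->
  Lq_norm q t f = ((\int[mu]_(s in `[0%R, t]) (`|f s| `^ q)%:E) `^ q^-1)%E.
Proof.
move=> q0; rewrite /Lq_norm unlock [in RHS]integral_mkcond; congr (_ `^ _)%E.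
apply: eq_integral => s _; rewrite /patch; case: ifP => _.
  by rewrite gee0_abs ?lee_fin// poweR_EFin.
by rewrite abse0 poweR0r// gt_eqF.
Qed.

Lemma integral_powR_lty (q t : R) (f : R -> E) : 0 < q -> (Lq_norm q t f < +oo)%E ->
  (\int[mu]_(s in `[0%R, t]) (`|f s| `^ q)%:E < +oo)%E.
Proof. by move=> q0; rewrite Lq_normE//; apply: lty_poweRy; rewrite invr_eq0 gt_eqF. Qed.

Lemma integral_powR_Lq_norm (q t : R) (f : R -> E) : 0 < q -> (Lq_norm q t f < +oo)%E ->
  (\int[mu]_(s in `[0%R, t]) (`|f s| `^ q)%:E = (fine (Lq_norm q t f) `^ q)%:E)%E.
Proof.
move=> q0 fq; have i0 : (0 <= \int[mu]_(s in `[0%R, t]) (`|f s| `^ q)%:E)%E.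
  by apply: integral_EFin_ge0 => s _; exact: powR_ge0.
rewrite -poweR_EFin fineK; last by rewrite ge0_fin_numE// Lq_normE// poweR_ge0.
by rewrite Lq_normE// -poweRrM mulVf ?gt_eqF// poweRe1.
Qed.

Lemma Lq_norm_le (q t a K : R) (f : R -> E) : 0 < q -> 0 <= a -> 0 <= K ->
  (\int[mu]_(s in `[0%R, t]) (`|f s| `^ q)%:E <= (K * a `^ q)%:E)%E ->
  (Lq_norm q t f <= (K `^ q^-1 * a)%:E)%E.
Proof.
move=> q0 a0 K0 h; rewrite Lq_normE//.
have i0 : (0 <= \int[mu]_(s in `[0%R, t]) (`|f s| `^ q)%:E)%E.
  by apply: integral_EFin_ge0 => s _; exact: powR_ge0.
apply: (@le_trans _ _ ((K * a `^ q)%:E `^ q^-1)%E).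
  apply: gt0_ler_poweR => //; first by rewrite invr_ge0 ltW.
  - by rewrite in_itv /= i0 leey.
  - by rewrite in_itv /= lee_fin mulr_ge0 ?powR_ge0//= leey.
rewrite poweR_EFin lee_fin powRM ?powR_ge0// -powRrM divff ?gt_eqF//.
by rewrite powRr1.
Qed.

End LqNorm.

Lemma class_Kinf_linear (R : realType) (k : R) : 0 < k -> class_Kinf (fun r => k * r).
Proof.
move=> k0; split.
- by rewrite mulr0.
- apply: continuous_subspaceT => r.
  by apply: cvgM; [exact: cvg_cst|exact: cvg_id].
- by move=> r s _ rs; rewrite ltr_pM2l.
- move=> M; exists ((`|M| + 1) / k); first by rewrite divr_ge0// ?addr_ge0// ltW.
  by rewrite mulrCA divff ?gt_eqF// mulr1 (le_lt_trans (ler_norm _))// ltrDl.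
Qed.

(** Since |j x| = |Rl x|, the kernels of [j] and [Rl] coincide, and [Rl] is injective because lambda
    - A maps Rl x back to [x]. *)
Lemma extrapolation_embedding_injective (R : realType) (X : normedModType R)
    (Xm1 : completeNormedModType R) (D : set X) (A : X -> X) (T : R -> X -> X)
    (lambda : R) (Rl : X -> X) (j : X -> Xm1) : generates D A T ->
  is_resolvent D A lambda Rl -> is_extrapolation_space Rl j -> injective j.
Proof.
move=> [[Tb _ _ _] hA] [bRl hRl _] [lj nj _] x y jxy.
apply/eqP; rewrite -subr_eq0; apply/eqP.
have Rl0 : Rl (x - y) = 0.
  by apply/eqP; rewrite -normr_eq0 -nj (linear_propB lj) jxy subrr normr0.
(* [A] is a bare function without assumed linearity; its value at 0 is read off from the orbit T h 0
   = 0. *)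
have A0 : A 0 = 0.
  suff /hA[] : h^-1 *: (T h 0 - 0) @[h --> 0^'+] --> (0 : X) by [].
  apply: (@cvg_trans _ ((fun=> 0 : X) @ 0^'+)); last exact: cvg_cst.
  apply: near_eq_cvg; near=> h.
  have h0 : 0 <= h by apply: ltW; near: h; exact: nbhs_right_gt.
  by rewrite (linear_prop0 (Tb h h0).1) subrr scaler0.
by have [_] := hRl (x - y); rewrite Rl0 scaler0 A0 subrr => <-.
Unshelve. all: by end_near. Qed.

Lemma extrapolation_embedding_bounded (R : realType) (X : normedModType R)
    (Xm1 : completeNormedModType R) (Rl : X -> X) (j : X -> Xm1) :
  bounded_operator Rl -> is_extrapolation_space Rl j -> bounded_operator j.
Proof.
move=> [lRl cRl] [lj nj _]; split=> // x; apply/cvgrPdist_le => e e0.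
have /cvgrPdist_le/(_ e e0) := cRl x; apply: filterS => y.
by rewrite -(linear_propB lRl) -(linear_propB lj) nj.
Qed.

Theorem theorem4p6 (R : realType) (X U Xm1 : completeNormedModType R)
    (D : set X) (A : X -> X) (T : R -> X -> X) (hA : generates D A T)
    (lambda : R) (Rl : X -> X) (hRl : is_resolvent D A lambda Rl)
    (j : X -> Xm1) (hj : is_extrapolation_space Rl j)
    (Tm1 : R -> Xm1 -> Xm1) (hTm1 : is_extension_semigroup j T Tm1)
    (B : U -> Xm1) (hB : bounded_operator B)
    (hC : C_admissible j Tm1 B)
    (hcont : continuous_mild_solutions j T Tm1 B)
    (q : R) (hq : 1 <= q) :
  (exists V : X -> R, noncoercive_ISS_Lyapunov j T Tm1 B q V) ->
  LqLq_ISS j T Tm1 B q.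
Proof.
move=> [V hV]; have q0 : 0 < q by rewrite (lt_le_trans _ hq).
have ij := extrapolation_embedding_injective hA hRl hj.
have [bRl _ _] := hRl.
have bj := extrapolation_embedding_bounded bRl hj.
have hT := hA.1; have [hS hTS] := hTm1; have [lj _] := bj.
have [K K0 energy] := lyapunov_energy_le hT hS hB ij hTS hq hV.
(* With r the norm of the input, both |x|^q and r^q are at most (|x| + r)^q, so the sum |x|^q + 2^q
   r^q is at most (1 + 2^q) (|x| + r)^q; a q-th root then gives a bound linear in |x| + r. *)
pose K' := K * (1 + 2 `^ q).
have K'0 : 0 < K' by rewrite mulr_gt0// addr_gt0// powR_gt0.
have estimate t x (u : R -> U) : 0 <= t -> in_Lq q t u ->
    exists2 g : R -> X, represents_Lq j q t (fun s => mild j T Tm1 B s x u) g &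
      (Lq_norm q t g <= (K' `^ q^-1 * (`|x| + fine (Lq_norm q t u)))%:E)%E.
  move=> t0 [su iu].
  have [g [sg ig gE]] := mild_Lq_estimate hT hS hB bj hcont x hq K0 t0
    (fun x u phi => energy t x u phi t0) su (integral_powR_lty q0 iu).
  have r0 : 0 <= fine (Lq_norm q t u) by rewrite fine_ge0// Lnorm_ge0.
  have gle : (Lq_norm q t g <= (K' `^ q^-1 * (`|x| + fine (Lq_norm q t u)))%:E)%E.
    apply: Lq_norm_le => //; [by rewrite addr_ge0|exact: ltW|].
    apply: le_trans ig _; rewrite integral_powR_Lq_norm//.
    rewrite (_ : (_ * _)%E = (K * (`|x| `^ q + 2 `^ q * fine (Lq_norm q t u) `^ q))%:E);
      last by rewrite EFinM EFinD EFinM.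
    rewrite lee_fin.
    rewrite /K' -mulrA ler_pM2l// mulrDl mul1r lerD//.
      by apply: ge0_ler_powR; rewrite ?nnegrE ?addr_ge0// ?lerDl// ltW.
    rewrite ler_wpM2l ?powR_ge0//.
    by apply: ge0_ler_powR; rewrite ?nnegrE ?addr_ge0// ?lerDr// ltW.
  by exists g => //; split=> //; split=> //; exact: le_lt_trans gle (ltry _).
split.
  (* Admissibility is the case of initial state 0, where the mild solution reduces to [Phi]. *)
  exists 1 => // u hu; have [g [gL gE] _] := estimate 1 0 u ler01 hu.
  exists g; split=> //; case: gE => N [mN N0 subN]; exists N; split=> // s /= nE.
  apply: subN => /= gE; apply: nE => sI; rewrite gE// /mild; have s0 : 0 <= s by move: sI; rewrite in_itv => /andP[].
  by have [Tb _ _ _] := hT; rewrite (linear_prop0 (Tb s s0).1) (linear_prop0 lj) add0r.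
have k0 : 0 < K' `^ q^-1 by rewrite powR_gt0.
exists (fun r => K' `^ q^-1 * r), (fun r => K' `^ q^-1 * r); split.
- exact: class_Kinf_linear.
- exact: class_Kinf_linear.
- move=> t x u t0 hu; have [g gE gle] := estimate t x u t0 hu.
  by exists g => //; rewrite -mulrDr.
Qed.
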